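(* Let $X$ be a closed linear subspace of $(BC(\mathbb{R}),\|\cdot\|_\infty)$ such that for every $l>0$ one has $T(f,g)\in X$ for all $f\in X$ and all $g\in X$ with $g(t)\ge l$ for all $t\in\mathbb{R}$. Let $F,G:X\to X$ be two maps, and write $F(x,t):=F(x)(t)$, $G(x,t):=G(x)(t)$. (1) Suppose that $F,G:(X,\|\cdot\|_\infty)\to(X,\|\cdot\|_\infty)$ are continuous, that $\inf_{x\in X,\,t\in\mathbb{R}}G(x,t)>0$, that there are real numbers $k\le M$ such that $F$ and $G$ are bounded on $B_{[k,M]}$ (i.e. $\sup_{x\in B_{[k,M]}}\|F(x)\|_\infty<\infty$ and $\sup_{x\in B_{[k,M]}}\|G(x)\|_\infty<\infty$) and $$k\le \frac{F(x,t)}{G(x,t)}\le M\quad\text{for all }(x,t)\in B_{[k,M]}\times\mathbb{R},$$ and that for every sequence $(x_n)\subset X$ converging uniformly on each compact subset of $\mathbb{R}$ to some element of $BC(\mathbb{R})$, the sequences $(F(x_n))$ and $(G(x_n))$ are relatively compact in $(X,\|\cdot\|_\infty)$. Then the equation $$x'(t)+G(x,t)\,x(t)=F(x,t),\qquad \forall t\in\mathbb{R},$$ has at least one solution $x^*\in B_{[k,M]}$. (2) Suppose instead that $F,G:(X,\|\cdot\|_\infty)\to(X,\|\cdot\|_\infty)$ are Lipschitz with Lipschitz constants $L_F$ and $L_G$ respectively, that $l:=\inf_{x\in X,\,t\in\mathbb{R}}G(x,t)>0$, and that there are real numbers $k\le M$ such that $k\le \frac{F(x,t)}{G(x,t)}\le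 M$ for all $(x,t)\in B_{[k,M]}\times\mathbb{R}$, $r:=\sup_{x\in B_{[k,M]}}\|F(x)\|_\infty<+\infty$, and $$\max\left(\frac{r}{l^2},\frac1l\right)(L_F+L_G)<1.$$ Then the same equation has a unique solution $x^*$ in $B_{[k,M]}$.
   Context: $BC(\mathbb{R})$ is the Banach space of bounded continuous functions $\mathbb{R}\to\mathbb{R}$ with the sup-norm $\|\cdot\|_\infty$. For $f,g\in BC(\mathbb{R})$ with $\inf_{t\in\mathbb{R}} g(t)>0$, $T(f,g)\in BC(\mathbb{R})$ denotes the function $$T(f,g)(t)=\int_{-\infty}^t e^{-\int_s^t g(u)\,du}f(s)\,ds,\qquad t\in\mathbb{R}.$$ For real $k\le M$, $B_{[k,M]}:=\{x\in X:\ x(t)\in[k,M]\ \forall t\in\mathbb{R}\}$. A solution of the equation is a differentiable function $x\in X$ satisfying it at every $t\in\mathbb{R}$. *)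

(* Defs.v *)
From HB Require Import structures.
From mathcomp Require Import all_boot all_order all_algebra.
From mathcomp Require Import all_classical all_reals all_analysis.

Set Implicit Arguments.
Unset Strict Implicit.
Unset Printing Implicit Defensive.

Import Order.TTheory GRing.Theory Num.Theory.
Import numFieldNormedType.Exports.

Local Open Scope classical_set_scope.
Local Open Scope ring_scope.

(* Bounded continuous functions are packaged as a type, so that the sup-norm
   gives them the library's normed module structure, hence its notions of
   closed set, continuity, Lipschitz map and precompactness. *)
Definition bounded_continuous (R : realType) : {pred R -> R} :=
  mem [set f : R -> R | continuous f /\ bounded_fun f].
Arguments bounded_continuous {R}.

Record BC (R : realType) := MkBC {
  BC_fun :> R -> R;
  BC_funP : BC_fun \in bounded_continuous }.

Section BC.
Context {R : realType}.

HB.instance Definition _ := [isSub for @BC_fun R].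
HB.instance Definition _ := [Choice of BC R by <:].

Lemma bounded_funE (f : R -> R) :
  bounded_fun f <-> has_ubound (range (fun t => `|f t|)).
Proof.
split=> [[M [_ fM]]|[M fM]].
  exists (M + 1) => _ [t _ <-].
  by apply: (fM (M + 1)) => //; rewrite ltrDl.
exists M; split; first exact: num_real.
move=> x Mx t _ /=; apply: le_trans (ltW Mx); apply: fM.
by exists t.
Qed.

Lemma bounded_continuous_submod : submod_closed (@bounded_continuous R).
Proof.
split=> [|a f g]; rewrite !inE/=.
  split; first by move=> x; exact: cst_continuous.
  by apply/bounded_funE; exists 0 => _ [t _ <-] /=; rewrite normr0.
move=> [cf /bounded_funE[A fA]] [cg /bounded_funE[B gB]]; split.
  move=> x; apply: (@continuousD _ _ _ (a *: f) g); last exact: cg.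
  by apply: (@continuousM _ _ (fun=> a) f x _ (cf x)); exact: cst_continuous.
apply/bounded_funE; exists (`|a| * A + B) => _ [t _ <-].
rewrite (le_trans (ler_normD _ _))// lerD//; last by apply: gB; exists t.
by rewrite normrM ler_wpM2l//; apply: fA; exists t.
Qed.

HB.instance Definition _ :=
  GRing.isSubmodClosed.Build R (R -> R) bounded_continuous
    bounded_continuous_submod.
HB.instance Definition _ := [SubChoice_isSubLmodule of BC R by <:].

Definition sup_norm (f : BC R) : R := sup (range (fun t => `|f t|)).

Lemma sup_norm_has_sup (f : BC R) : has_sup (range (fun t => `|f t|)).
Proof.
split; first by exists `|f 0|, 0.
by apply/bounded_funE; have := BC_funP f; rewrite inE => -[].
Qed.

Lemma sup_norm_ub (f : BC R) t : `|f t| <= sup_norm f.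
Proof. by apply: sup_upper_bound; [exact: sup_norm_has_sup|exists t]. Qed.

Lemma sup_norm_le (f : BC R) M : (forall t, `|f t| <= M) -> sup_norm f <= M.
Proof.
move=> fM; apply: ge_sup; first by case: (sup_norm_has_sup f).
by move=> _ [t _ <-].
Qed.

Lemma sup_norm_ge0 (f : BC R) : 0 <= sup_norm f.
Proof. exact: le_trans (sup_norm_ub f 0). Qed.

Lemma sup_normD (f g : BC R) : sup_norm (f + g) <= sup_norm f + sup_norm g.
Proof.
apply: sup_norm_le => t.
by rewrite (le_trans (ler_normD _ _))// lerD// sup_norm_ub.
Qed.

Lemma sup_normZ (a : R) (f : BC R) : sup_norm (a *: f) = `|a| * sup_norm f.
Proof.
have le_normZ b (g : BC R) : sup_norm (b *: g) <= `|b| * sup_norm g.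
  by apply: sup_norm_le => t; rewrite normrM ler_wpM2l// sup_norm_ub.
apply/eqP; rewrite eq_le le_normZ/=.
have [->|a0] := eqVneq a 0; first by rewrite normr0 mul0r sup_norm_ge0.
rewrite -ler_pdivlMl ?normr_gt0// -normfV.
by rewrite -[in leLHS](scalerK a0 f) le_normZ.
Qed.

Lemma sup_norm0_eq0 (f : BC R) : sup_norm f = 0 -> f = 0.
Proof.
move=> f0; apply/val_inj/funext => t /=; apply/eqP.
by rewrite -normr_le0 -f0 sup_norm_ub.
Qed.

HB.instance Definition _ :=
  Lmodule_isNormed.Build R (BC R) sup_normD sup_normZ sup_norm0_eq0.

Definition T (f g : R -> R) (t : R) : R :=
  \int[lebesgue_measure]_(s in `]-oo, t])
    (expR (- \int[lebesgue_measure]_(u in `[s, t]) g u) * f s).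

Definition band (X : set (BC R)) (k M : R) : set (BC R) :=
  [set x | X x /\ forall t, k <= x t <= M].

Definition solution (F G : BC R -> BC R) (x : BC R) : Prop :=
  forall t, derivable x t 1 /\ derive1 x t + G x t * x t = F x t.

End BC.

(* Main.v *)
(* If g >= l > 0, then T(f, g) is the only bounded solution of y' + g y = f, so
   the solutions of the equation are the fixed points of Phi x = T(F x, G x).
   A single comparison principle (a bounded y with y' + g y <= c g satisfies
   y <= c) gives T(g, g) = 1, whence X contains the constants, the invariance
   of the band under Phi, and the estimate
     |T(f1, g1) - T(f2, g2)| <= (|f1 - f2| + |g1 - g2| |T(f2, g2)|) / l.
   With this estimate (2) is Banach's fixed point theorem.
   For (1), Phi maps the band into the closed convex set C of its L-Lipschitz
   elements, for a suitable L. By Arzela-Ascoli every sequence of C has a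
   subsequence converging locally uniformly, along which F and G are relatively
   compact; hence Phi(C) is relatively compact and Schauder's theorem applies.
   Schauder's theorem is reduced to Brouwer's by finite nets, and Brouwer's
   theorem is deduced from Scarf's lemma on finite sets with several linear
   orders, which replaces Sperner's lemma and needs no triangulation. *)

Require Import Defs.
From HB Require Import structures.
From mathcomp Require Import all_boot all_order all_algebra.

Set Implicit Arguments.
Unset Strict Implicit.
Unset Printing Implicit Defensive.

(** * Scarf's lemma *)

(* [rk i] ranks [T] by the [i]-th linear order and [c] is a colouring. The
   argument is that of Petri and Voorneveld: rooms and doors play the part of
   the simplices of a triangulation and of their facets. The doors considered
   are those whose labels [D] are [i0 |: c @: t], so they are indexed by [t].
   A nonempty door borders an even number of rooms and the empty door exactly
   one, while a room which is not colourful has zero or two doors. *)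
Section Scarf.
Variables (T I : finType) (rk : I -> T -> nat) (c : T -> I) (i0 : I).
Hypothesis rk_inj : forall i, injective (rk i).
Implicit Types (s t : {set T}) (C D : {set I}) (p : {set T} * {set I}).

(** Geometrically, no point lies above the minima of [s] in all orders of [C]; this emptiness is the
    substitute for being a simplex. *)
Definition dominant s C :=
  [forall y, exists i in C, forall x in s, rk i y <= rk i x].

Definition room p := dominant p.1 p.2 && (#|p.1| == #|p.2|).

Definition door t := (#|c @: t| == #|t|) && (i0 \notin c @: t).

Definition door_labels t := i0 |: c @: t.

Definition incident p t := [&& room p, door t &
  (p.2 == door_labels t) && [exists y in ~: t, p.1 == y |: t]
  || (p.1 == t) && [exists j in door_labels t, p.2 == door_labels t :\ j]].

Lemma dominantP s C :
  reflect (forall y, exists2 i, i \in C & forall x, x \in s -> rk i y <= rk i x)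
          (dominant s C).
Proof.
apply: (iffP forallP) => h y; first have /exists_inP[i iC /forall_inP] := h y.
  by exists i.
by have [i iC hi] := h y; apply/exists_inP; exists i => //; apply/forall_inP.
Qed.

Lemma card_door_labels t : door t -> #|door_labels t| = #|t|.+1.
Proof. by case/andP=> /eqP ct i0t; rewrite cardsU1 i0t ct add1n. Qed.

(** The only label is [i0], so the one room consists of the [i0]-greatest point; a room without
    points would have no label to dominate [x0]. *)
Lemma rooms_of_empty_door (x0 : T) : #|[set p | incident p set0]| = 1.
Proof.
have D0 : door_labels set0 = [set i0] by rewrite /door_labels imset0 setU0.
have [m _ mmax] := @arg_maxnP _ x0 xpredT (rk i0) isT.
rewrite -(cards1 ([set m], [set i0])); congr #|pred_of_set _|.
apply/setP => -[s C]; rewrite !inE /incident /room /door D0 imset0 cards0 inE /=.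
apply/idP/idP.
  case/andP=> /andP[/dominantP dom /eqP sC] /andP[_ /orP[|]].
    case/andP => /eqP CE /exists_inP[y _ /eqP]; rewrite setU0 => sE.
    apply/eqP; rewrite CE sE in dom *; congr (_, _); congr [set _].
    have [i /set1P -> /(_ y) le] := dom m; apply: (rk_inj (i := i0)).
    by apply/eqP; rewrite eqn_leq le ?set11 // andbT; apply: mmax.
  case/andP=> /eqP s0 _; move: sC dom; rewrite s0 cards0 => /esym/cards0_eq ->.
  by move/(_ x0) => [i]; rewrite inE.
case/eqP=> -> ->; rewrite !cards1 cards0 !eqxx /= !andbT; apply/andP; split.
  by apply/dominantP => y; exists i0; rewrite ?set11// => x /set1P ->; apply: mmax.
by apply/orP; left; apply/exists_inP; exists m; rewrite ?inE// setU0.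
Qed.

(** * The two rooms bordering a nonempty door *)

Section NonemptyDoor.
Variables (t : {set T}) (D : {set I}) (x0 : T).
Hypotheses (x0t : x0 \in t) (cardD : #|D| = #|t|.+1) (domD : dominant t D).

Let m i := [arg min_(x < x0 in t) rk i x].

Let m_in i : m i \in t.
Proof. by rewrite /m; case: arg_minnP. Qed.

Let m_min i x : x \in t -> rk i (m i) <= rk i x.
Proof. by rewrite /m; case: arg_minnP => // y _ h xt; apply: h. Qed.

Let m_eq i x : x \in t -> (forall y, y \in t -> rk i x <= rk i y) -> m i = x.
Proof.
move=> xt xmin; apply: (rk_inj (i := i)); apply/eqP.
by rewrite eqn_leq m_min //= xmin.
Qed.

Let m_image C : dominant t C -> m @: C = t.
Proof.
move=> /dominantP dom; apply/setP => x; apply/imsetP/idP => [[i _ ->] //|xt].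
by have [i iC xmin] := dom x; exists i => //; rewrite (m_eq xt xmin).
Qed.

Let twins : exists j1 j2, [/\ j1 \in D, j2 \in D, j1 != j2 & m j1 = m j2].
Proof.
have : ~~ [forall i in D, forall j in D, (m i == m j) ==> (i == j)].
  apply/negP => /forall_inP inj.
  suff : #|m @: D| = #|D| by rewrite m_image // cardD => /eqP; rewrite eqn_leq ltnn andbF.
  apply: card_in_imset => i j iD jD /eqP mij.
  by move: (inj i iD) => /forall_inP/(_ j jD); rewrite mij => /eqP.
case/forall_inPn => i iD /forall_inPn[j jD]; rewrite negb_imply => /andP[/eqP mij ij].
by exists i, j.
Qed.

Let above j := [set y | [forall i in D :\ j, rk i (m i) < rk i y]].

Let not_dominant j : ~~ dominant t (D :\ j) = (above j != set0).
Proof.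
apply/idP/set0Pn => [/forallPn[y /exists_inPn h]|[y]].
  exists y; rewrite inE; apply/forall_inP => i iD.
  have /forall_inPn[x xt] := h i iD; rewrite -ltnNge; apply: leq_ltn_trans.
  exact: m_min.
rewrite inE => /forall_inP h; apply/negP => /dominantP/(_ y)[i iD hi].
by have := h i iD; rewrite ltnNge hi.
Qed.

Let top j :=
  odflt x0 [pick y in above j | [forall z in above j, rk j z <= rk j y]].

Let other j := if dominant t (D :\ j) then (t, D :\ j) else (top j |: t, D).

Let topP j : ~~ dominant t (D :\ j) ->
  top j \in above j /\ forall y, y \in above j -> rk j y <= rk j (top j).
Proof.
rewrite not_dominant => /set0Pn[y yM]; rewrite /top.
case: pickP => [z /andP[zM /forall_inP] //|none].
have [z zM zmax] := @arg_maxnP _ y [in above j] (rk j) yM.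
have /andP[] := none z; split; first exact: zM.
by apply/forall_inP => x xM; apply: zmax.
Qed.

(* Since [dominant t D], every element of [t] is the [i]-least one for some [i]
   in [D]; as [#|D| = #|t|.+1], exactly two indices [j1], [j2] share their least
   element. Each [j] of them yields one room, [other j]: drop the label [j] if
   what remains is dominant, and otherwise add to [t] the [j]-greatest of the
   points lying above the other minima. *)
Lemma even_rooms_of_door : ~~ odd #|[set p | room p &&
  ((p.2 == D) && [exists y in ~: t, p.1 == y |: t]
  || (p.1 == t) && [exists j in D, p.2 == D :\ j])]|.
Proof.
have [j1 [j2 [j1D j2D j12 mj]]] := twins.
(* If the minima still cover [t] without [j], counting makes [m] injective on [D :\ j], so [j] is
   one of the two indices sharing a minimum. *)
have removal j : j \in D -> m @: (D :\ j) = t -> j = j1 \/ j = j2.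
  move=> jD img; have [->|jj1] := eqVneq j j1; first by left.
  have [->|jj2] := eqVneq j j2; first by right.
  case/negP: j12; apply/eqP.
  have: {in D :\ j &, injective m}.
    apply/imset_injP; rewrite img; apply/eqP.
    by have := cardsD1 j D; rewrite jD cardD add1n => -[].
  by apply; rewrite ?inE // 1?eq_sym ?jj1 ?jj2.
have img_twin j : j = j1 \/ j = j2 -> m @: (D :\ j) = t.
  move=> jE; rewrite -(m_image domD); apply/setP => x; apply/imsetP/imsetP.
    by case=> i /setD1P[_ iD] ->; exists i.
  case=> i iD ->; have [ij|ij] := eqVneq i j; last by exists i; rewrite // !inE ij.
  case: jE => jE; [exists j2|exists j1]; rewrite ?inE ?ij ?jE ?mj ?j1D ?j2D ?andbT //.
  by rewrite eq_sym.
have top_notin j : j = j1 \/ j = j2 -> ~~ dominant t (D :\ j) -> top j \notin t.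
  move=> jE /topP[+ _]; rewrite inE => /forall_inP topM; apply/negP => topt.
  move: topt; rewrite -{1}(img_twin j jE) => /imsetP[i iD mi].
  by have := topM i iD; rewrite mi ltnn.
have other_room j : j = j1 \/ j = j2 -> room (other j).
  move=> jE; rewrite /other; case: ifPn => [dom|ndom]; rewrite /room /=.
    have jD : j \in D by case: jE => ->.
    by rewrite dom /=; have := cardsD1 j D; rewrite jD cardD add1n => -[->].
  rewrite cardsU1 top_notin // cardD add1n eqxx andbT.
  (* A point of [above j] is dominated by [t] only through [j], where [top j] is greatest; any other
     point is below a minimum [m i] with [i] distinct from [j], and [top j] exceeds that minimum. *)
  have [topM topmax] := topP ndom; apply/dominantP => z.
  have [zM|] := boolP (z \in above j).
    have /dominantP/(_ z)[i iD zi] := domD.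
    have ij : i = j.
      apply/eqP/negP => /negP ij; move: zM; rewrite inE => /forall_inP/(_ i).
      by rewrite !inE ij iD => /(_ isT); rewrite ltnNge zi.
    exists i => // x /setU1P[->|]; last exact: zi.
    by rewrite ij; apply: topmax.
  rewrite inE => /forall_inPn[i iDj]; rewrite -leqNgt => zi.
  exists i => [|x /setU1P[->|xt]]; first by case/setD1P: iDj.
    by apply: (leq_trans zi); move: topM; rewrite inE => /forall_inP/(_ i iDj)/ltnW.
  exact: leq_trans zi (m_min _ _).
suff -> : [set p | room p &&
  ((p.2 == D) && [exists y in ~: t, p.1 == y |: t]
  || (p.1 == t) && [exists j in D, p.2 == D :\ j])] = [set other j1; other j2].
  rewrite cards2 (_ : other j1 != other j2) //; apply/eqP; rewrite /other.
  have tN j : j = j1 \/ j = j2 -> ~~ dominant t (D :\ j) -> top j |: t <> t.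
    by move=> jE dj tE; have := top_notin j jE dj; rewrite -tE setU11.
  case: ifPn => d1; case: ifPn => d2.
  - case=> /setP/(_ j1); rewrite !inE eqxx j12 j1D //.
  - by case=> /esym/tN; case/(_ (or_intror erefl) d2).
  - by case=> /tN; case/(_ (or_introl erefl) d1).
  - case=> tops.
    have [M1 _] := topP d1; have [M2 _] := topP d2.
    have top12 : top j1 = top j2.
      have := setU11 (top j1) t; rewrite tops => /setU1P[//|].
      by rewrite (negPf (top_notin _ (or_introl erefl) d1)).
    have /dominantP/(_ (top j1))[i iD hi] := domD.
    have [ij|ij] := eqVneq i j1.
      move: M2; rewrite inE => /forall_inP/(_ i); rewrite !inE ij j12 -ij iD.
      by move/(_ isT); rewrite -top12 ltnNge hi.
    move: M1; rewrite inE => /forall_inP/(_ i); rewrite !inE ij iD.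
    by move/(_ isT); rewrite ltnNge hi.
apply/setP => p; rewrite inE; apply/idP/set2P; last first.
  move=> h; have {h} [j [jE ->]] : exists j, (j = j1 \/ j = j2) /\ p = other j.
    by case: h => ->; [exists j1|exists j2]; split; auto.
  rewrite other_room //= /other; case: ifPn => d /=; apply/orP; [right|left].
    rewrite eqxx /=; apply/exists_inP; exists j => //.
    by case: jE => ->.
  rewrite eqxx /=; apply/exists_inP; exists (top j); rewrite ?inE //.
  exact: top_notin.
case: p => s C /andP[/andP[/= dom sC] /orP[|]]; last first.
  case/andP=> /eqP sE /exists_inP[j jD /eqP CE]; rewrite {}sE {}CE in dom sC *.
  by case: (removal j jD (m_image dom)) => <-; rewrite /other dom; [left|right].
case/andP=> /eqP CE /exists_inP[y]; rewrite inE => yt /eqP sE.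
rewrite {}sE {}CE in dom sC *.
have /dominantP domy := dom.
have [j jD jy] := domy y.
have yM : y \in above j.
  rewrite inE; apply/forall_inP => i /setD1P[ij iD].
  (* If [y] were least for both [i] and [j], the minima for the remaining labels, one fewer than the
     elements of [t], would have to cover [t]. *)
  rewrite ltnNge; apply/negP => yi.
  have {}yi : forall z, z \in t -> rk i y <= rk i z.
    by move=> z zt; apply: leq_trans yi (m_min _ _).
  suff img : m @: (D :\ i :\ j) = t.
    have := leq_imset_card m (D :\ i :\ j); rewrite img.
    have := cardsD1 i D; rewrite iD cardD add1n => -[->].
    by rewrite (cardsD1 j (D :\ i)) !inE eq_sym ij jD /= add1n ltnn.
  apply/setP => x; apply/imsetP/idP => [[k _ ->]//|xt].
  have [k kD kx] := domy x; exists k; last first.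
    by apply/esym/m_eq => // z zt; apply: kx; rewrite inE zt orbT.
  have nk k' : (forall z, z \in t -> rk k' y <= rk k' z) -> k != k'.
    move=> k'y; apply/eqP => kk; case/negP: yt.
    suff -> : y = x by [].
    apply: (rk_inj (i := k)); apply/eqP; rewrite eqn_leq kx ?setU11 // andbT.
    by rewrite kk k'y.
  by rewrite !inE kD (nk j) ?(nk i) // => z zt; apply: jy; rewrite inE zt orbT.
have ndom : ~~ dominant t (D :\ j) by rewrite not_dominant; apply/set0Pn; exists y.
have [topM topmax] := topP ndom.
have ytop : y = top j.
  apply: (rk_inj (i := j)); apply/eqP; rewrite eqn_leq topmax //=.
  have [i iD hi] := domy (top j).
  have [ij|ij] := eqVneq i j; first by move: (hi y (setU11 _ _)); rewrite ij.
  move: topM; rewrite inE => /forall_inP/(_ i); rewrite !inE ij iD => /(_ isT).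
  by rewrite ltnNge hi // inE m_in orbT.
(* No element of [t] is dominated through [j] in the room, where [y] is the [j]-least point; so the
   minima for [D :\ j] still cover [t]. *)
have: j = j1 \/ j = j2.
  apply: removal => //; apply/setP => x; apply/imsetP/idP => [[k _ ->]//|xt].
  have [k kD kx] := domy x; exists k; last first.
    by apply/esym/m_eq => // z zt; apply: kx; rewrite inE zt orbT.
  rewrite !inE kD andbT; apply/eqP => kj; case/negP: yt.
  suff -> : y = x by [].
  apply: (rk_inj (i := k)); apply/eqP; rewrite eqn_leq kx ?setU11 // andbT.
  by rewrite kj jy // inE xt orbT.
by case=> jE; [left|right]; rewrite -jE /other (negPf ndom) -ytop.
Qed.

End NonemptyDoor.

(** A room with a door can be written [y |: t] with the labels of a door [t]. If [y] shares its
    colour with some [z] in [t], its doors arise by deleting [y] or [z]; otherwise they are [t] and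
    [y |: t]. *)
Lemma even_doors_of_room p : c @: p.1 != p.2 ->
  ~~ odd #|[set t | incident p t]|.
Proof.
case: p => s C /= cs; have [->|/set0Pn[t]] := eqVneq [set t | incident (s, C) t] set0.
  by rewrite cards0.
have injP t' : door t' -> {in t' &, injective c}.
  by case/andP=> /imset_injP.
have labels t' : door t' -> c @: t' = door_labels t' :\ i0.
  by case/andP=> _ i0t; rewrite /door_labels setU1K.
rewrite inE => h.
(* If the given door has the same points as the room, the missing label is a colour [c y], since
   omitting [i0] would make the room colourful; deleting [y] then gives a door with labels [C]. *)
have {t h} [t [roomp dt CE [y yt sE]]] : exists t, [/\ room (s, C), door t,
    C = door_labels t & exists2 y, y \notin t & s = y |: t].
  case/and3P: h => rp dt /orP[|]; last first.
    case/andP => /eqP /= sE /exists_inP[j jD /eqP CE].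
    move: jD => /setU1P[j0|].
      by case/negP: cs; rewrite sE CE j0 labels.
    case/imsetP => y yt jE.
    have cy : c @: (t :\ y) = c @: t :\ j.
      apply/setP => k; apply/imsetP/setD1P => [[z /setD1P[zy zt] ->]|[kj]].
        split; last exact: imset_f.
        by rewrite jE; apply: contraNneq zy => /(injP _ dt) ->.
      case/imsetP => z zt kE; exists z => //; rewrite !inE zt andbT.
      by apply: contraNneq kj => zy; rewrite kE zy jE.
    have jc : j \in c @: t by rewrite jE imset_f.
    have ji0 : j != i0 by case/andP: dt => _; apply: contraNneq => <-.
    exists (t :\ y); split=> //.
    - case/andP: (dt) => /eqP ct i0t; apply/andP; split; last first.
        by rewrite cy; apply: contra i0t => /setD1P[].
      apply/imset_injP => u v /setD1P[_ ut] /setD1P[_ vt]; exact: (injP t dt).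
    - rewrite CE /door_labels cy; apply/setP => k; rewrite !inE.
      by have [->|_] := eqVneq k j; rewrite ?(negPf ji0).
    - by exists y; rewrite ?setD11 // setD1K // sE.
  case/andP=> /eqP CE /exists_inP[y]; rewrite inE => yt /eqP sE.
  by exists t; split=> //; exists y.
have csE : c @: s = c y |: c @: t by rewrite sE imsetU1.
have cyi0 : c y != i0.
  by apply: contra_neq cs => cy; rewrite csE CE cy.
have sy : s :\ y = t by rewrite sE setU1K.
have incP t' : incident (s, C) t' = door t' &&
    ([exists z in s, (t' == s :\ z) && (c @: t' == c @: t)]
     || (t' == s) && (c y \notin c @: t)).
  rewrite /incident roomp /=; case dt': (door t') => //=.
  congr (_ || _).
    apply/andP/exists_inP => [[/eqP CE' /exists_inP[z]]|[z zs /andP[/eqP tE /eqP cE]]].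
      rewrite inE => zt /eqP sz; exists z; first by rewrite sz setU11.
      by rewrite sz setU1K // eqxx labels // -CE' CE -labels ?eqxx.
    split; first by rewrite CE /door_labels cE.
    by apply/exists_inP; exists z; rewrite tE ?inE ?eqxx // setD1K.
  rewrite eq_sym; case: eqVneq => // tE /=; subst t'.
  have := injP _ dt' => injs.
  have cyt : c y \notin c @: t.
    apply/imsetP => -[z zt cyz]; case/negP: yt.
    suff -> : y = z by [].
    by apply: injs; rewrite // sE ?setU11 // inE zt orbT.
  rewrite cyt; apply/exists_inP; exists (c y).
    by rewrite /door_labels csE !inE eqxx orbT.
  rewrite CE /door_labels csE; apply/eqP/setP => k; rewrite !inE.
  case: (eqVneq k (c y)) => [->|//]; first by rewrite (negPf cyi0) (negPf cyt).
have [/imsetP[z zt cyz]|cyt] := boolP (c y \in c @: t).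
  have zy : z != y by apply: contraNneq yt => <-.
  have zs : z \in s by rewrite sE inE zt orbT.
  have ys : y \in s by rewrite sE setU11.
  have csz : c @: (s :\ z) = c @: t.
    apply/setP => k; apply/imsetP/imsetP => -[u].
      rewrite sE !inE => /andP[uz /orP[/eqP ->|ut]] ->; last by exists u.
      by exists z.
    move=> ut ->; have [->|uz] := eqVneq u z.
      by exists y; rewrite // !inE eq_sym zy.
    by exists u; rewrite // sE !inE uz ut orbT.
  suff -> : [set t' | incident (s, C) t'] = [set t; s :\ z].
    rewrite cards2 (_ : t != s :\ z) //.
    by apply/eqP => /setP/(_ z); rewrite zt !inE eqxx.
  apply/setP => t'; rewrite inE incP [in X in _ = X]inE !inE; apply/idP/idP.
    case/andP=> dt' /orP[|].
      case/exists_inP => u us /andP[/eqP tE _].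
      have [uy|uy] := eqVneq u y; first by rewrite tE uy sy eqxx.
      have [uz|uz] := eqVneq u z; first by rewrite tE uz eqxx orbT.
      case/negP: zy; apply/eqP; apply: (injP _ dt'); rewrite ?tE ?inE ?zs ?ys //.
        by rewrite andbT eq_sym.
      by rewrite andbT eq_sym.
    by rewrite cyz imset_f // andbF.
  case/orP => /eqP ->.
    rewrite dt /=; apply/orP; left; apply/exists_inP; exists y => //.
    by rewrite sy !eqxx.
  have dz : door (s :\ z).
    case/andP: dt => /eqP ct i0t; rewrite /door csz i0t ct andbT.
    have := cardsD1 z s; rewrite zs sE cardsU1 yt => /eqP.
    by rewrite !add1n eqSS.
  rewrite dz /=; apply/orP; left; apply/exists_inP; exists z => //.
  by rewrite csz !eqxx.
have ds : door s.
  case/andP: dt => /eqP ct i0t; rewrite /door csE cardsU1 cyt ct sE cardsU1 yt eqxx.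
  by rewrite !inE negb_or eq_sym cyi0.
have ys : y \in s by rewrite sE setU11.
suff -> : [set t' | incident (s, C) t'] = [set t; s].
  rewrite cards2 (_ : t != s) //; apply/eqP => ts.
  by case/negP: yt; rewrite ts.
apply/setP => t'; rewrite inE incP [in X in _ = X]inE !inE cyt andbT; apply/idP/idP.
  case/andP=> _ /orP[|->]; last by rewrite orbT.
  case/exists_inP => u us /andP[/eqP tE /eqP cE].
  suff uy : u = y by rewrite tE uy sy eqxx.
  apply/eqP/negP => /negP uy; case/negP: cyt; rewrite -cE imset_f //.
  by rewrite tE !inE eq_sym uy.
case/orP => /eqP ->; last by rewrite ds eqxx orbT.
rewrite dt /=; apply/orP; left; apply/exists_inP; exists y => //.
by rewrite sy !eqxx.
Qed.

(** Without a colourful room, the incidences counted by rooms are even in number; counted by doors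
    they are odd, because only the empty door contributes an odd number. *)
Theorem colourful_room (x0 : T) :
  exists s, dominant s (c @: s) /\ #|s| = #|c @: s|.
Proof.
suff /existsP[s /andP[dom /eqP card]] :
    [exists s, dominant s (c @: s) && (#|s| == #|c @: s|)] by exists s.
apply: contraT => /existsPn none.
have even2 n : ~~ odd n -> 2 %| n by rewrite dvdn2.
have : 2 %| \sum_t #|[set p | incident p t]|.
  rewrite (eq_bigr (fun t => \sum_p (incident p t : nat))); last first.
    by move=> t _; rewrite -sum1dep_card big_mkcond.
  rewrite exchange_big /= (eq_bigr (fun p => #|[set t | incident p t]|)); last first.
    by move=> p _; rewrite -sum1dep_card [RHS]big_mkcond.
  apply: dvdn_sum => -[s C] _; apply: even2.
  have [cs|] := eqVneq (c @: s) C; last by move=> cs; exact: (@even_doors_of_room (s, C)).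
  rewrite (_ : [set _ | _] = set0) ?cards0 //; apply/setP => t; rewrite !inE.
  by apply/negP => /andP[]; rewrite /room /= -cs (negPf (none s)).
rewrite (bigD1 set0) //= (rooms_of_empty_door x0) dvdn_addl //.
apply: dvdn_sum => t /set0Pn[x xt]; apply: even2.
(* Dominance survives fewer points and more labels, so a door bordering some room is dominant with
   its own labels. *)
have [dt|ndt] := boolP (door t && dominant t (door_labels t)); last first.
  rewrite (_ : [set _ | _] = set0) ?cards0 //; apply/setP => -[s C]; rewrite !inE.
  apply: contraNF ndt => /and3P[/andP[/= /dominantP dom _] -> h] /=.
  apply/dominantP => y; have [i iC hi] := dom y; exists i.
    move: h => /orP[/andP[/eqP <-]//|/andP[_ /exists_inP[j _ /eqP CE]]].
    by move: iC; rewrite CE => /setD1P[].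
  move=> z zt; apply: hi.
  by case/orP: h => [/andP[_ /exists_inP[u _ /eqP ->]]|/andP[/eqP -> //]]; rewrite inE zt orbT.
case/andP: dt => dt domt.
rewrite (eq_card (B := [set p | room p &&
  ((p.2 == door_labels t) && [exists y in ~: t, p.1 == y |: t]
  || (p.1 == t) && [exists j in door_labels t, p.2 == door_labels t :\ j])])).
  exact: (even_rooms_of_door xt (card_door_labels dt) domt).
by move=> p; rewrite !inE /incident dt.
Qed.

End Scarf.

From mathcomp Require Import all_classical all_reals all_analysis.
From mathcomp Require Import measurable_realfun.
From mathcomp Require Import ring lra zify.

Import Order.TTheory GRing.Theory Num.Theory.
Import numFieldNormedType.Exports.

Local Open Scope classical_set_scope.
Local Open Scope ring_scope.

(** * Brouwer's theorem *)

Section Grid.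
Variables (n N : nat).

Definition grid := {x : {ffun 'I_n.+1 -> 'I_N.+1} | (\sum_i x i == N)%N}.

Definition grid_coord (x : grid) i : nat := sval x i.

Lemma sum_grid_coord x : (\sum_i grid_coord x i = N)%N.
Proof. exact/eqP/(svalP x). Qed.

Lemma gridP (y : 'I_n.+1 -> nat) : (\sum_i y i = N)%N ->
  exists x : grid, forall i, grid_coord x i = y i.
Proof.
move=> yN; have yle i : (y i < N.+1)%N by rewrite ltnS -yN (bigD1 i) //= leq_addr.
have xP : (\sum_i [ffun i => Ordinal (yle i)] i == N)%N.
  by apply/eqP; rewrite -[RHS]yN; apply: eq_bigr => i _; rewrite ffunE.
exists (@exist _ (fun x : {ffun 'I_n.+1 -> 'I_N.+1} => (\sum_i x i == N)%N) _ xP) => i.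
by rewrite /grid_coord /= ffunE.
Qed.

(* The enumeration rank breaks ties, so that equal coordinates are still
   strictly ordered. *)
Definition grid_rank i (x : grid) : nat :=
  (grid_coord x i * #|{: grid}| + enum_rank x)%N.

Lemma grid_rank_inj i : injective (grid_rank i).
Proof.
move=> x y /(congr1 (modn^~ #|{: grid}|)); rewrite !modnMDl !modn_small //.
by move/val_inj/enum_rank_inj.
Qed.

Lemma grid_rank_le i x y :
  (grid_rank i x <= grid_rank i y)%N -> (grid_coord x i <= grid_coord y i)%N.
Proof.
move=> h; rewrite leqNgt; apply/negP => lt.
suff : (grid_rank i y < grid_rank i x)%N by rewrite ltnNge h.
rewrite /grid_rank; apply: (@leq_trans ((grid_coord y i).+1 * #|{: grid}|)).
  by rewrite mulSn addnC ltn_add2r.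
by apply: leq_trans (leq_addr _ _); rewrite leq_mul2r lt orbT.
Qed.

(** By dominance no grid point exceeds the minima over [s] in all coordinates of the colour set [C],
    so these minima sum to at least [N - n]. As each point has coordinate sum [N], at most [n] is
    left for its excess over them and for its coordinates outside [C]. *)
Lemma small_colourful_room (c : grid -> 'I_n.+1) : exists s : {set grid},
  [/\ s != finset.set0,
      forall x y i, x \in s -> y \in s -> (grid_coord x i <= grid_coord y i + n)%N &
      forall x i, x \in s -> i \notin c @: s -> (grid_coord x i <= n)%N].
Proof.
have [x0 _] : exists x : grid, forall i, grid_coord x i = (if i == ord0 then N else 0%N).
  by apply: gridP; rewrite -big_mkcond big_pred1_eq.
have [s [/dominantP dom _]] := colourful_room c ord0 grid_rank_inj x0.
set C := c @: s in dom *.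
have [i0 i0C _] := dom x0.
have [x1 x1s _] := imsetP i0C.
pose m i := [arg min_(x < x1 in s) grid_coord x i].
have ms i : m i \in s by rewrite /m; case: arg_minnP.
have mmin i x : x \in s -> (grid_coord (m i) i <= grid_coord x i)%N.
  by rewrite /m; case: arg_minnP => // y _ h xs; apply: h.
have low : (N < \sum_(i in C) (grid_coord (m i) i).+1)%N.
  rewrite ltnNge; apply/negP => le.
  pose d := (N - \sum_(i in C) (grid_coord (m i) i).+1)%N.
  (* This point exceeds every minimum on [C]; the leftover [d] goes to [i0], a label of [C], to
     bring the sum to [N]. *)
  pose y i := ((if i \in C then (grid_coord (m i) i).+1 else 0) + (i == i0) * d)%N.
  have [z zE] : exists z : grid, forall i, grid_coord z i = y i.
    apply: gridP; rewrite big_split /= -big_mkcond /= -big_distrl /=.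
    have -> : (\sum_i (i == i0) = 1)%N.
      by rewrite (bigD1 i0) //= eqxx big1 // => i /negPf ->.
    by rewrite mul1n subnKC.
  have [i iC /(_ _ (ms i)) /grid_rank_le] := dom z.
  by rewrite zE /y iC addSn ltnNge leq_addr.
have Cn : (#|C| <= n.+1)%N by rewrite -[leqRHS]card_ord max_card.
have low' : (N < \sum_(i in C) grid_coord (m i) i + n.+1)%N.
  apply: leq_trans low _; rewrite (eq_bigr (fun i => grid_coord (m i) i + 1)%N).
    by rewrite big_split /= sum1_card leq_add2l.
  by move=> i _; rewrite addn1.
have sumle x (P : pred 'I_n.+1) : x \in s ->
    (\sum_(i in C | P i) grid_coord (m i) i <= \sum_(i in C | P i) grid_coord x i)%N.
  by move=> xs; apply: leq_sum => i _; apply: mmin.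
have out x i : x \in s -> i \notin C -> (grid_coord x i <= n)%N.
  move=> xs iC.
  have := sum_grid_coord x; rewrite (bigD1 i) //= (bigID (fun j => j \in C)) /=.
  rewrite (eq_bigl (fun j => j \in C)); last first.
    by move=> j /=; apply: andb_idl => jC; apply: contraNneq iC => <-.
  have : (\sum_(j in C) grid_coord (m j) j <= \sum_(j in C) grid_coord x j)%N.
    by apply: leq_sum => j _; apply: mmin.
  move: low'; lia.
exists s; split=> //; first by apply/set0Pn; exists x1.
move=> x y i xs ys; have [iC|iC] := boolP (i \in C); last first.
  by apply: leq_trans (out x i xs iC) _; rewrite leq_addl.
apply: (@leq_trans (grid_coord (m i) i + n)%N); last by rewrite leq_add2r mmin.
have := sum_grid_coord x; rewrite (bigID (fun j => j \in C)) /= (bigD1 i) //=.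
have := sumle x (predC1 i) xs; move: low'; rewrite (bigD1 i) //=.
lia.
Qed.

End Grid.

(** * Passage to the limit over finer grids *)

Section Brouwer.
Variable R : realType.

Definition simplex n : set 'rV[R]_n :=
  [set x | (forall i, 0 <= x 0 i) /\ \sum_i x 0 i = 1].

Lemma continuous_sumR (U : topologicalType) n (f : 'I_n -> U -> R) :
  (forall i, continuous (f i)) -> continuous (fun x => \sum_i f i x).
Proof. by move=> cf; apply: continuous_big => [|i _]; [exact: add_continuous|exact: cf]. Qed.

Lemma simplex_le1 n (x : 'rV[R]_n) i : simplex x -> x 0 i <= 1.
Proof.
by case=> x0 <-; rewrite (bigD1 i) //= lerDl sumr_ge0.
Qed.

Lemma simplex_compact n : compact (@simplex n).
Proof.
have cube : compact [set v : 'rV[R]_n | forall i, v ord0 i \in `[0, 1]].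
  apply: (@rV_compact _ _ (fun=> `[(0 : R), 1]%classic)).
  by move=> i; exact: segment_compact.
apply: (subclosed_compact _ cube).
- have -> : @simplex n = (\bigcap_(i in [set: 'I_n]) [set x | 0 <= x 0 i]) `&`
      [set x | \sum_i x 0 i = 1].
    by apply/seteqP; split => x [x0 x1]; split => // i; [move=> _|]; apply: x0.
  have ci (i : 'I_n) : continuous (fun x : 'rV[R]_n => x 0 i) by exact: coord_continuous.
  apply: closedI.
    by apply: closed_bigI => i _; apply: (preimage_closed _ (@closed_ge R 0)) => x _; exact: ci.
  apply: (@preimage_closed _ _ (fun x : 'rV[R]_n => \sum_i x 0 i) [set y | y = 1]) => // x _.
  exact: continuous_sumR.
- by move=> x sx i /=; rewrite in_itv /= simplex_le1 // andbT; case: sx.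
Qed.

Variables (n : nat) (h : 'I_n.+1 -> 'rV[R]_n.+1 -> R).
Hypotheses (h_ge0 : forall i x, 0 <= h i x).

Let S x := \sum_i h i x.

(** A grid point is coloured by an index [i] at which [q 0 i * S q <= h i q]. In a small colourful
    room each [i] is either a colour, giving the first alternative, or absent, which forces a small
    coordinate. *)
Lemma approx_brouwer N : (0 < N)%N -> exists2 p, simplex p & forall i,
  exists2 q, simplex q /\ (forall j, `|p 0 j - q 0 j| <= n%:R / N%:R) &
    q 0 i * S q <= h i q \/ q 0 i <= n%:R / N%:R.
Proof.
move=> N0; have NR : 0 < N%:R :> R by rewrite ltr0n.
pose pt (x : grid n N) : 'rV[R]_n.+1 := \row_i ((grid_coord x i)%:R / N%:R).
have pt_simplex x : simplex (pt x).
  split=> [i|]; first by rewrite mxE divr_ge0.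
  rewrite (eq_bigr (fun i => (grid_coord x i)%:R / N%:R)); last by move=> i _; rewrite mxE.
  by rewrite -mulr_suml -natr_sum sum_grid_coord divff // gt_eqF.
pose c x := odflt ord0 [pick i | pt x 0 i * S (pt x) <= h i (pt x)].
have cP x : pt x 0 (c x) * S (pt x) <= h (c x) (pt x).
  rewrite /c; case: pickP => //= none.
  (* The default [ord0] is never reached: the coordinates sum to 1, so adding up the opposite strict
     inequalities is absurd. *)
  suff : S (pt x) < S (pt x) by rewrite ltxx.
  rewrite -[ltRHS]mul1r -(pt_simplex x).2 mulr_suml.
  by apply: ltr_sum => [|i _]; [apply/hasP; exists ord0; rewrite ?mem_index_enum|
    rewrite ltNge none].
have [s [/set0Pn[x xs] close out]] := small_colourful_room c.
exists (pt x) => // i.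
have [/imsetP[y ys iE]|ni] := boolP (i \in c @: s); last first.
  exists (pt x); first by split=> // j; rewrite subrr normr0 divr_ge0.
  by right; rewrite mxE ler_pM2r ?invr_gt0 // ler_nat out.
exists (pt y); last by left; rewrite iE.
split=> // j; rewrite !mxE -mulrBl normrM (ger0_norm (x := _^-1)) ?invr_ge0 //.
rewrite ler_pM2r ?invr_gt0 // ler_norml.
have := close x y j xs ys; have := close y x j ys xs.
by rewrite -!(ler_nat R) !natrD => h1 h2; apply/andP; split; lra.
Qed.

Hypothesis h_cont : forall i, {within @simplex n.+1, continuous (h i)}.

(* This is Brouwer's theorem for the map [h / S] of the simplex into itself,
   multiplied out so that zeros of [S] are harmless. *)
Lemma homogeneous_brouwer : exists2 x, simplex x & forall i, h i x = x 0 i * S x.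
Proof.
have h1 N : exists p, simplex p /\ forall i,
  exists2 q, simplex q /\ (forall j, `|p 0 j - q 0 j| <= n%:R / N.+1%:R) &
    q 0 i * S q <= h i q \/ q 0 i <= n%:R / N.+1%:R.
  by have [p] := approx_brouwer (ltn0Sn N); exists p.
have {h1}[p pP] := choice h1.
have [x [sx clx]] : @simplex n.+1 `&` cluster (p @ \oo) !=set0.
  by apply: simplex_compact; exists 0%N => // N _; case: (pP N).
exists x => //.
have hx i : h i z @[z --> within (@simplex n.+1) (nbhs x)] --> h i x.
  by move/subspace_continuousP: (h_cont (i := i)); apply.
have Sx : S z @[z --> within (@simplex n.+1) (nbhs x)] --> S x.
  by apply: cvg_big => [|i _]; [exact: add_continuous|exact: hx].
have S0 z : 0 <= S z by exact: sumr_ge0.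
(* Both sides have sum [S x] over [i], so these inequalities are all equalities. *)
suff le i : x 0 i * S x <= h i x.
  move=> i; apply/eqP; rewrite eq_sym eq_le le /=.
  have: \sum_(j | j != i) x 0 j * S x <= \sum_(j | j != i) h j x.
    by apply: ler_sum => j _; exact: le.
  have: x 0 i * S x + \sum_(j | j != i) x 0 j * S x = S x.
    by rewrite -[RHS]mul1r -sx.2 mulr_suml [RHS](bigD1 i).
  have : h i x + \sum_(j | j != i) h j x = S x by rewrite [RHS](bigD1 i).
  lra.
rewrite leNgt; apply/negP => lt.
have xi0 : 0 < x 0 i.
  have := sx.1 i; rewrite le_eqVlt => /orP[/eqP x0|//].
  by move: lt; rewrite -x0 mul0r ltNge h_ge0.
have cx : (fun z : 'rV[R]_n.+1 => z 0 i) z @[z --> within (@simplex n.+1) (nbhs x)] --> x 0 i.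
  by apply: cvg_within_filter; apply: coord_continuous.
have : \forall z \near within (@simplex n.+1) (nbhs x), h i z < z 0 i * S z /\ x 0 i / 2 < z 0 i.
  near=> z; split; last first.
    by near: z; apply: (cvgr_gt _ cx); rewrite ltr_pdivrMr // mulr_natr mulr2n ltrDr.
  rewrite -subr_gt0; near: z.
  apply: (cvgr_gt (x 0 i * S x - h i x)); last by rewrite subr_gt0.
  by apply: cvgB; [exact: cvgM|exact: hx].
move=> /nbhs_ballP[e /= e0 near_x].
(* The first bound keeps [q] in the ball of radius [e], the second rules out the alternative of a
   small coordinate. *)
pose d := Num.min (e / 2) (x 0 i / 2).
have d0 : 0 < d by rewrite lt_min !divr_gt0.
have small : \forall N \near \oo, n%:R / N.+1%:R < d.
  near=> N; rewrite ltr_pdivrMr ?ltr0n // mulrC -ltr_pdivrMr //.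
  rewrite (@lt_trans _ _ N%:R) ?ltr_nat //; near: N; exact: nbhs_infty_gtr.
have [z [[N Nd <-] xz]] : (p @` [set N | n%:R / N.+1%:R < d]) `&` ball x (e / 2) !=set0.
  apply: clx; last by apply: nbhsx_ballx; rewrite divr_gt0.
  by apply: filterS small => N Nd; exists N.
have [sp /(_ i)[q [sq pq]]] := pP N.
have /near_x/(_ sq)[hq xq] : ball x e q.
  apply: (ball_split xz); split=> [|k j]; first by rewrite divr_gt0.
  rewrite ord1 /ball /=; apply: le_lt_trans (pq j) _.
  by apply: lt_le_trans Nd _; rewrite ge_min lexx.
case=> [|qi]; first by rewrite leNgt hq.
have := lt_trans xq (le_lt_trans qi Nd).
by rewrite lt_min ltxx andbF.
Unshelve. all: by end_near. Qed.

End Brouwer.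

(** * The linear equation y' + g y = f *)

Section LinearODE.
Variable R : realType.
Implicit Types (f g y df dy A : R -> R) (l c B M L : R).
Notation mu := (@lebesgue_measure R).

Lemma is_derive_MVT f df : (forall x : R, is_derive x 1 f (df x)) ->
  forall a b, a <= b -> exists c, f b - f a = df c * (b - a).
Proof.
move=> fdf a b ab; have cf : continuous f.
  by move=> x; apply/differentiable_continuous/derivable1_diffP/ex_derive.
have [c _ ->] := @MVT_segment R f df a b ab (fun x _ => fdf x) (continuous_subspaceT cf).
by exists c.
Qed.

Lemma is_derive_nonincreasing f df : (forall x : R, is_derive x 1 f (df x)) ->
  (forall x, df x <= 0) -> forall a b, a <= b -> f b <= f a.
Proof.
move=> fdf df0 a b ab; have [c fE] := is_derive_MVT fdf ab.
by rewrite -subr_le0 fE mulr_le0_ge0 // subr_ge0.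
Qed.

Lemma is_derive_lipschitz f df L : (forall x : R, is_derive x 1 f (df x)) ->
  (forall x, `|df x| <= L) -> forall a b, `|f b - f a| <= L * `|b - a|.
Proof.
move=> fdf dfL a b; wlog ab : a b / a <= b.
  by move=> h; case: (leP a b) => [/h//|/ltW/h]; rewrite distrC (distrC a).
by have [c ->] := is_derive_MVT fdf ab; rewrite normrM ler_wpM2r.
Qed.

Lemma continuous_integrable_itv g a b : continuous g -> mu.-integrable `[a, b] (EFin \o g).
Proof.
move=> cg; apply: continuous_compact_integrable; first exact: segment_compact.
exact: continuous_subspaceT.
Qed.

Lemma Rintegral_itv_cat g a b c : continuous g -> a <= b -> b <= c ->
  \int[mu]_(u in `[a, c]) g u =
  \int[mu]_(u in `[a, b]) g u + \int[mu]_(u in `[b, c]) g u.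
Proof.
move=> cg ab bc; rewrite -(@Rintegral_itv_obnd_cbnd _ b); last first.
  apply: integrableS (continuous_integrable_itv b c cg) => //.
  exact: subset_itv_oc_cc.
by rewrite -(@Rintegral_itvB _ _ (BLeft a)) ?bnd_simp // ?subrKC //;
  exact: continuous_integrable_itv.
Qed.

Lemma Rintegral_itv_empty g a b : b <= a -> \int[mu]_(u in `[a, b]) g u = 0.
Proof.
rewrite le_eqVlt => /orP[/eqP ->|ba]; first by rewrite set_itv1 Rintegral_set1.
by rewrite set_itv_ge ?Rintegral_set0 // bnd_simp -ltNge.
Qed.

(** Integrals over empty intervals vanish, so the difference defining [A] is the signed integral
    from 0 to [t]. *)
Lemma continuous_antiderivative g : continuous g ->
  exists A, (forall t : R, is_derive t 1 A (g t)) /\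
    forall s t, s <= t -> \int[mu]_(u in `[s, t]) g u = A t - A s.
Proof.
move=> cg.
pose A t := \int[mu]_(u in `[0, t]) g u - \int[mu]_(u in `[t, 0]) g u.
have AE a t : a <= 0 -> a <= t ->
    A t = \int[mu]_(u in `[a, t]) g u - \int[mu]_(u in `[a, 0]) g u.
  move=> a0 at_; rewrite /A; have [t0|/ltW t0] := leP t 0.
    by rewrite (Rintegral_itv_cat cg at_ t0) (Rintegral_itv_empty _ t0); ring.
  by rewrite (Rintegral_itv_cat cg a0 t0) (Rintegral_itv_empty _ t0); ring.
exists A; split=> [t|s t st]; last first.
  pose a := Num.min s 0.
  have as_ : a <= s by rewrite ge_min lexx.
  have a0 : a <= 0 by rewrite ge_min lexx orbT.
  rewrite (AE a t) ?(AE a s) // ?(le_trans as_) //.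
  by rewrite (Rintegral_itv_cat cg as_ st); ring.
(* Starting to the left of 0 and [t], [A] is near [t] an ordinary integral minus a constant, and the
   fundamental theorem applies. *)
pose a := Num.min t 0 - 1.
have at_ : a < t by rewrite ltrBlDr gt_min ltrDl ltr01.
have a0 : a <= 0 by rewrite lerBlDr ge_min add0r ler01 orbT.
pose P z := \int[mu]_(u in `[a, z]) g u.
have [dP P'] : derivable P t 1 /\ derive1 P t = g t.
  apply: (@continuous_FTC1_closed _ _ _ _ (t + 1)) => //; last exact: cg.
  by rewrite ltrDl.
  exact: continuous_integrable_itv.
have dPt : is_derive t 1 P (g t) by apply: DeriveDef => //; rewrite -derive1E.
have {}dPt : is_derive t 1 (P - cst (P 0)) (g t).
  by apply: is_derive_eq; rewrite subr0.
apply: near_eq_is_derive dPt.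
near=> z; rewrite (AE a z) //; apply: ltW; near: z; exact: lt_nbhsr.
Unshelve. all: by end_near. Qed.

Lemma antiderivative_growth g l A : (forall t, l <= g t) ->
  (forall t : R, is_derive t 1 A (g t)) -> forall s t, s <= t -> l * (t - s) <= A t - A s.
Proof.
move=> lg dA s t st; have [c ->] := is_derive_MVT dA st.
by rewrite ler_wpM2r // subr_ge0.
Qed.

(* Multiplying by the integrating factor [expR A], with [A] an antiderivative
   of [g], turns the hypothesis into a monotonicity statement; boundedness of
   [y] then kills the contribution from minus infinity. *)
Lemma bounded_subsolution_le y dy g l c B : (forall t : R, is_derive t 1 y (dy t)) ->
  (forall t, `|y t| <= B) -> continuous g -> 0 < l -> (forall t, l <= g t) ->
  (forall t, dy t + g t * y t <= c * g t) -> forall t, y t <= c.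
Proof.
move=> dY yB cg l0 lg sub t; rewrite leNgt; apply/negP => ct.
have [A [dA _]] := continuous_antiderivative cg.
pose E : R -> R := (expR \o A) * (y - cst c).
have dE (s : R) : is_derive s 1 E (expR (A s) * (dy s + g s * (y s - c))).
  rewrite /E; apply: is_derive_eq.
  by rewrite /GRing.scale /= subr0 !fctE; ring.
have Emono := is_derive_nonincreasing dE.
set d := y t - c; have d0 : 0 < d by rewrite subr_gt0.
have B0 : 0 <= B by exact: le_trans (yB 0).
pose K := B + `|c|.
have K0 : 0 < K.
  apply: lt_le_trans d0 _; rewrite lerD //; first exact: le_trans (ler_norm _) (yB t).
  by rewrite -normrN ler_norm.
(* [K] bounds [y - c]. From [s] to [t] the function [A] grows by at least [K / d], so
   [expR (A t - A s) * d] is at least [d + K], beyond its bound [K]. *)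
pose s := t - K / d / l.
have st : s <= t by rewrite gerBl !divr_ge0 // ltW.
have le : E t <= E s.
  apply: Emono st => u; rewrite mulr_ge0_le0 ?expR_ge0 // mulrBr (mulrC _ c) addrA subr_le0.
  exact: sub.
have {le} le : expR (A t) * d <= expR (A s) * (y s - c) by exact: le.
have {le} : expR (A t - A s) * d <= K.
  rewrite expRD expRN mulrAC ler_pdivrMr ?expR_gt0 // (le_trans le) // mulrC.
  rewrite ler_pM2r ?expR_gt0 // /K lerD //; first exact: le_trans (ler_norm _) (yB s).
  by rewrite -normrN ler_norm.
rewrite leNgt => /negP; apply.
have : 1 + K / d <= expR (A t - A s).
  apply: le_trans (expR_ge1Dx _) _; rewrite ler_expR.
  apply: le_trans (antiderivative_growth lg dA st).
  have -> : t - s = K / d / l by rewrite /s; ring.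
  by rewrite [leRHS]mulrC divfK // gt_eqF.
rewrite -(ler_pM2r d0); apply: lt_le_trans.
by rewrite mulrDl mul1r divfK ?gt_eqF // ltrDr.
Qed.

(** After reflecting [s] into [- s], the integrand has the antiderivative [- G], which tends to 0 at
    plus infinity. *)
Lemma expR_integrableNy l u : 0 < l -> mu.-integrable `]-oo, u] (EFin \o (fun s => expR (l * s))).
Proof.
move=> l0.
have cE k : continuous (fun s : R => expR (k * s)).
  move=> s; apply: continuous_comp; last exact: continuous_expR.
  by apply: continuousM; [exact: cst_continuous|exact: id].
apply/integrableP; split.
  by apply/measurable_EFinP; apply: measurable_funTS; exact: continuous_measurable_fun.
under eq_integral => s _ do rewrite /= ger0_norm ?expR_ge0 //.
rewrite -(opprK u) ge0_integration_by_substitutionNy; last 2 first.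
  exact: continuous_subspaceT.
  by move=> s _; exact: expR_ge0.
pose G : R -> R := l^-1 *: (expR \o (- l *: id)).
have dG (s : R) : is_derive s 1 G (- expR (- l * s)).
  apply: is_derive_eq; rewrite !fctE /= /GRing.scale /= mulr1 mulrN mulrN.
  by rewrite mulrCA mulVf ?mulr1 // gt_eqF.
rewrite (@ge0_continuous_FTC2y _ _ (- G) _ 0) ?ltry //.
- by move=> s _; exact: expR_ge0.
- apply: continuous_subspaceT => s /=.
  by apply: continuous_comp; [exact: continuousN|exact: cE].
- rewrite -oppr0; apply: cvgN; rewrite -(mulr0 l^-1); apply: cvgM; first exact: cvg_cst.
  rewrite (_ : expR \o _ = (fun z => expR (- z)) \o (fun z => l * z)); last first.
    by apply/funext => x; rewrite /= -mulNr.
  apply: (@cvg_comp _ _ _ _ _ _ (pinfty_nbhs R)); last exact: cvgr_expR.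
  exact: gt0_cvgMry.
- apply: cvg_at_right_filter; apply: cvgN.
  exact/differentiable_continuous/derivable1_diffP/ex_derive.
- move=> s _; rewrite derive1E derive_val opprK /=.
  by rewrite mulrN mulNr.
Qed.

(** Splitting the inner integral through [A] gives [T f g = expR (- A) * P], a product to
    differentiate. Since [A] grows at rate at least [l], a multiple of [expR (l * s)] dominates the
    integrand of [P]. *)
Lemma T_is_derive f g l M : continuous f -> (forall t, `|f t| <= M) ->
  continuous g -> 0 < l -> (forall t, l <= g t) ->
  forall t : R, is_derive t 1 (T f g) (f t - g t * T f g t).
Proof.
move=> cf fM cg l0 lg t.
have [A [dA intA]] := continuous_antiderivative cg.
have cA : continuous A.
  by move=> s; apply/differentiable_continuous/derivable1_diffP/ex_derive.
pose q s := expR (A s) * f s.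
have cq : continuous q.
  move=> s; apply: (@continuousM _ _ (expR \o A) f s _ (cf s)).
  by apply: continuous_comp; [exact: cA|exact: continuous_expR].
have intq u : mu.-integrable `]-oo, u] (EFin \o q).
  apply: (@le_integrable _ _ _ mu _ _ _
    (fun s => (M * expR (A u - l * u) * expR (l * s))%:E)) => //.
  - by apply/measurable_EFinP; apply: measurable_funTS; exact: continuous_measurable_fun.
  - move=> s /=; rewrite in_itv /= => su; rewrite lee_fin.
    have M0 : 0 <= M by exact: le_trans (fM 0).
    rewrite /q normrM [leRHS]ger0_norm ?mulr_ge0 ?expR_ge0 // mulrC -mulrA.
    rewrite ler_pM // ger0_norm ?expR_ge0 // -expRD ler_expR.
    by have := antiderivative_growth lg dA su; rewrite mulrBr; lra.
  - exact: (integrableZl _ (M * expR (A u - l * u)) (expR_integrableNy u l0)).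
pose P u := \int[mu]_(s in `]-oo, u]) q s.
have TE : T f g = (expR \o (- A)) * P.
  apply/funext => u; rewrite /T /P fctE /= -RintegralZl //.
  apply: eq_Rintegral => s; rewrite inE /= in_itv /= => su.
  by rewrite intA // opprB addrC expRD /q mulrA.
have [dP P'] : derivable P t 1 /\ derive1 P t = q t.
  apply: (@continuous_FTC1 _ _ _ _ (t + 1)); [by rewrite ltrDl|exact: intq|by rewrite ltNyr|exact: cq].
have dPt : is_derive t 1 P (q t).
  by apply: DeriveDef; [exact: dP|rewrite -P' derive1E].
rewrite TE; apply: is_derive_eq.
rewrite /q !fctE /= /GRing.scale /=.
have E1 : expR (- A t) * expR (A t) = 1 by rewrite mulrC expRxMexpNx_1.
rewrite -[in RHS](mul1r (f t)) -E1; ring.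
Qed.

End LinearODE.

(** * Schauder's theorem *)

Section Schauder.
Variables (R : realType) (V : normedModType R).

Lemma closed_approxP (C : set V) : closed C <->
  forall z, (forall e, 0 < e -> exists2 w, C w & `|w - z| < e) -> C z.
Proof.
split=> [cC z approx|approx z clz].
  apply: cC => B /nbhs_ballP[e /= e0 zB].
  have [w Cw wz] := approx e e0; exists w; split=> //.
  by apply: zB; rewrite -ball_normE /= distrC.
apply: approx => e e0; have [w [Cw]] := clz _ (nbhsx_ballx z e e0).
by rewrite -ball_normE /= distrC => wz; exists w.
Qed.

Variables (C : set V) (Phi : V -> V).
Hypotheses (C_closed : closed C) (C_neq0 : C !=set0).
Hypothesis C_convex : forall n (v : 'I_n -> V) (a : 'rV[R]_n),
  (forall i, C (v i)) -> simplex a -> C (\sum_i a 0 i *: v i).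
Hypotheses (Phi_C : forall x, C x -> C (Phi x)) (Phi_cont : {within C, continuous Phi}).
Hypothesis Phi_compact : forall x : nat -> V, (forall n, C (x n)) ->
  exists z, forall e N, 0 < e -> exists2 m, (N <= m)%N & `|Phi (x m) - z| < e.

(** Otherwise points of [C] could be picked one after another with images pairwise at distance at
    least [e], against [Phi_compact]. *)
Lemma finite_net e : 0 < e -> exists s : seq V, (forall w, w \in s -> C w) /\
  forall x, C x -> exists2 w, w \in s & `|Phi x - Phi w| < e.
Proof.
move=> e0; apply: contrapT => no_net.
have far (s : seq V) : exists x, (forall w, w \in s -> C w) ->
    C x /\ forall w, w \in s -> e <= `|Phi x - Phi w|.
  have [sC|] := pselect (forall w, w \in s -> C w); last by exists 0.
  have [x xP] : exists x, ~ (C x -> exists2 w, w \in s & `|Phi x - Phi w| < e).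
    by apply/existsNP => h; apply: no_net; exists s.
  exists x => _; split; first by apply: contrapT => nCx; apply: xP.
  move=> w ws; rewrite leNgt; apply/negP => lt; apply: xP => _; by exists w.
have [pick pickP] := choice far.
pose s := fix s n := if n is n'.+1 then pick (s n') :: s n' else [::].
have sC n w : w \in s n -> C w.
  elim: n w => [|n IHn] w //; rewrite inE => /orP[/eqP ->|/IHn //].
  by case: (pickP (s n) IHn).
have mem_s m n : (m < n)%N -> pick (s m) \in s n.
  elim: n => // n IHn; rewrite ltnS leq_eqVlt => /orP[/eqP ->|/IHn mn].
    by rewrite inE eqxx.
  by rewrite inE mn orbT.
have [z zP] := Phi_compact (fun n => (pickP (s n) (@sC n)).1).
have e20 : 0 < e / 2 by rewrite divr_gt0.
have [m _ mz] := zP _ 0%N e20; have [n mn nz] := zP _ m.+1 e20.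
have := (pickP (s n) (@sC n)).2 _ (mem_s m n mn).
rewrite leNgt => /negP; apply; rewrite -(subrKA z) (splitr e).
by rewrite (le_lt_trans (ler_normD _ _)) // ltrD // distrC.
Qed.

(** This is the Schauder projection. The weight [h i a] vanishes unless [v i] is within [e] of
    [Phi (comb a)], and the Brouwer equation makes [a] proportional to the weights; so [comb a]
    averages points within [e] of its image. *)
Lemma approx_fixpoint e : 0 < e -> exists2 x, C x & `|Phi x - x| <= e.
Proof.
move=> e0; have [s [sC net]] := finite_net e0.
have [n sz] : exists n, size s = n.+1.
  case: s net {sC} => [|w s] net; last by exists (size s).
  by have [x /net[]] := C_neq0.
pose v (i : 'I_n.+1) := Phi (nth 0 s i).
have vC i : C (v i) by apply: Phi_C; apply: sC; rewrite mem_nth // sz.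
pose comb (a : 'rV[R]_n.+1) := \sum_i a 0 i *: v i.
have combC a : simplex a -> C (comb a) by exact: C_convex.
have comb_cont : continuous comb.
  apply: continuous_big => [|i _ a]; first exact: add_continuous.
  have ci : continuous (fun b : 'rV[R]_n.+1 => b 0 i) by exact: coord_continuous.
  exact: (cvgZr_tmp (ci a)).
(* [u i a + `|u i a|] is twice the positive part of [u i a]. *)
pose u i a := e - `|Phi (comb a) - v i|.
pose h i a := u i a + `|u i a|.
have h_ge0 i a : 0 <= h i a by rewrite -lerBlDl sub0r -normrN ler_norm.
have h_gt0 i a : (0 < h i a) = (0 < u i a).
  rewrite /h; case: (ltP 0 (u i a)) => [u0|u0]; first by rewrite addr_gt0 // normr_gt0 gt_eqF.
  by rewrite (ler0_norm u0) subrr ltxx.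
have [a sa aP] : exists2 a, simplex a & forall i, h i a = a 0 i * \sum_j h j a.
  apply: homogeneous_brouwer => // i.
  apply/subspace_continuousP => a sa.
  have cPhi : Phi (comb b) @[b --> within (@simplex R n.+1) (nbhs a)] --> Phi (comb a).
    have /subspace_continuousP/(_ _ (combC a sa)) cP := Phi_cont.
    apply: (cvg_comp _ _ _ cP) => A wA.
    have nA : \forall b \near a, C (comb b) -> A (comb b) by exact: (comb_cont a _ wA).
    have : \forall b \near a, simplex b -> A (comb b).
      by apply: filterS nA => b Ab sb; exact: Ab (combC b sb).
    by [].
  have cu : u i b @[b --> within (@simplex R n.+1) (nbhs a)] --> u i a.
    exact: (cvgB (cvg_cst e) (cvg_norm (cvgB cPhi (cvg_cst (v i))))).
  exact: (cvgD cu (cvg_norm cu)).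
exists (comb a); first exact: combC.
have S0 : 0 < \sum_j h j a.
  have [w ws wlt] := net _ (combC a sa).
  have iw : (index w s < n.+1)%N by rewrite -sz index_mem.
  apply: (@lt_le_trans _ _ (h (Ordinal iw) a)).
    by rewrite h_gt0 subr_gt0 /v /= nth_index.
  by rewrite (bigD1 (Ordinal iw)) //= lerDl sumr_ge0.
have -> : Phi (comb a) - comb a = \sum_i a 0 i *: (Phi (comb a) - v i).
  rewrite (eq_bigr (fun i => a 0 i *: Phi (comb a) - a 0 i *: v i)); last first.
    by move=> i _; rewrite scalerBr.
  by rewrite sumrB -scaler_suml sa.2 scale1r.
apply: le_trans (ler_norm_sum _ _ _) _.
rewrite -[leRHS]mul1r -sa.2 mulr_suml; apply: ler_sum => i _.
rewrite normrZ ger0_norm ?sa.1 //.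
have := sa.1 i; rewrite le_eqVlt => /orP[/eqP <-|ai0]; first by rewrite !mul0r.
rewrite ler_pM2l //.
have : 0 < h i a by rewrite aP mulr_gt0.
by rewrite h_gt0 subr_gt0 => /ltW.
Qed.

(** Approximate fixed points and their images cluster at the same [z], and continuity on [C] gives
    [Phi z = z]. *)
Lemma schauder : exists2 x, C x & Phi x = x.
Proof.
have approx n : exists x, C x /\ `|Phi x - x| <= n.+1%:R^-1.
  by have [|x] := @approx_fixpoint n.+1%:R^-1; [rewrite invr_gt0|exists x].
have [x xP] := choice approx.
have [z zP] := Phi_compact (fun n => (xP n).1).
have near_z e : 0 < e -> exists n, `|Phi (x n) - z| < e /\ `|x n - z| < e.
  move=> e0; have e20 : 0 < e / 2 by rewrite divr_gt0.
  (* From this index on, the error [1 / (n + 1)] is below [e / 2]. *)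
  have [n nn nz] := zP _ (Num.truncn (e / 2)^-1) e20; exists n; split.
    by apply: lt_trans nz _; rewrite ltr_pdivrMr // mulr_natr mulr2n ltrDl.
  rewrite -(subrKA (Phi (x n))) (splitr e) (le_lt_trans (ler_normD _ _)) // ltrD //.
  rewrite distrC (le_lt_trans (xP n).2) // -[ltRHS]invrK ltf_pV2 ?posrE ?invr_gt0 //.
  by apply: lt_le_trans (truncnS_gt _) _; rewrite ler_nat ltnS.
have Cz : C z.
  have /closed_approxP := C_closed; apply=> e /near_z[n [_ xz]].
  by exists (x n) => //; case: (xP n).
exists z => //; apply/eqP; rewrite -subr_eq0 -normr_eq0 eq_le normr_ge0 andbT.
apply/ler_addgt0Pr => e e0; rewrite add0r.
have e20 : 0 < e / 2 by rewrite divr_gt0.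
have /subspace_continuousP/(_ _ Cz)/cvgrPdist_lt/(_ _ e20) := Phi_cont.
move=> /nbhs_ballP[d /= d0 near_Phi].
have [|n [Pn xn]] := near_z (Num.min d (e / 2)); first by rewrite lt_min d0.
move: Pn xn; rewrite !lt_min => /andP[_ Pn] /andP[xn _].
rewrite -(subrKA (Phi (x n))) (splitr e) (le_trans (ler_normD _ _)) // lerD //; last exact: ltW.
apply/ltW/near_Phi; last by case: (xP n).
by rewrite -ball_normE /= distrC.
Qed.

End Schauder.

(** * Compactness and completeness *)

Section ArzelaAscoli.
Variable R : realType.

(** The nodes run from [- (n + 1)] to [n + 1] with step [1 / (n + 1)], so range and precision
    improve together; rounding down gives [j]. *)
Lemma grid_point (n : nat) (t : R) : `|t| <= n.+1%:R ->
  exists j : 'I_(2 * n.+1 * n.+1).+1,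
    `|t - (j%:R / n.+1%:R - n.+1%:R)| <= n.+1%:R^-1.
Proof.
rewrite ler_norml => /andP[t1 t2]; set c : R := n.+1%:R.
have c0 : 0 < c by rewrite ltr0n.
have s0 : 0 <= (t + c) * c by apply: mulr_ge0; lra.
have /andP[lo hi] := truncn_itv s0.
have jlt : (Num.truncn ((t + c) * c) < (2 * n.+1 * n.+1).+1)%N.
  rewrite ltnS -(ler_nat R) (le_trans lo) // natrM natrM ler_pM2r //.
  by rewrite mulr_natl mulr2n lerD2r.
exists (Ordinal jlt) => /=; set j := (Num.truncn _)%:R in lo *.
have -> : t - (j / c - c) = ((t + c) * c - j) / c by field; rewrite gt_eqF.
have ci0 : 0 <= c^-1 by rewrite invr_ge0 ltW.
rewrite normrM (ger0_norm ci0); apply: ler_piMl => //.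
rewrite ger0_norm ?subr_ge0 // lerBlDr ltW //.
by move: hi; rewrite -[(Num.truncn _).+1]add1n natrD.
Qed.

(** By Tychonoff's theorem the functions with values in [[k, M]] are compact for pointwise
    convergence, and conditions at finitely many points define a neighbourhood of the cluster
    point. *)
Lemma cluster_arrow (x : nat -> R -> R) k M : (forall n t, k <= x n t <= M) ->
  exists y : R -> R, forall m (q : 'I_m -> R) e N, 0 < e ->
    exists2 n, (N <= n)%N & forall i, `|y (q i) - x n (q i)| < e.
Proof.
move=> xkM.
have cpt := @tychonoff R (fun=> R) (fun=> `[k, M]%classic) (fun=> @segment_compact _ k M).
have [|y [_ cly]] := cpt (x @ \oo) _.
  by exists 0%N => // n _ t /=; rewrite in_itv /= xkM.
exists y => m q e N e0.
pose near_y : set_system (R -> R) := nbhs (y : prod_topology (fun _ : R => R)).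
have near_yF : Filter near_y by exact: (nbhs_filter (y : prod_topology (fun _ : R => R))).
have near_yq : near_y [set f | forall i, `|y (q i) - f (q i)| < e].
  have := @filter_forall (R -> R) 'I_m (fun i f => `|y (q i) - f (q i)| < e) near_y near_yF.
  apply=> i; have /cvgrPdist_lt/(_ e e0) := @proj_continuous _ (fun _ : R => R) (q i) y.
  exact.
have [|_ [[n Nn <-] xn]] := cly (x @` [set n | (N <= n)%N]) _ _ near_yq.
  by exists N => // n Nn; exists n.
by exists n.
Qed.

(* [y] is a pointwise cluster point; by the Lipschitz bound, closeness to [y] on
   a finite grid is enough for closeness on a compact interval. *)
Lemma arzela_ascoli_lipschitz (x : nat -> R -> R) k M L : (forall n t, k <= x n t <= M) ->
  (forall n s t, `|x n s - x n t| <= L * `|s - t|) ->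
  exists y : R -> R, [/\ forall t, k <= y t <= M,
    forall s t, `|y s - y t| <= L * `|s - t| &
    exists2 m : nat -> nat, (forall n, (n <= m n)%N) &
      {family compact, (fun n => x (m n)) @ \oo --> y}].
Proof.
move=> xkM xL; have [y yP] := cluster_arrow xkM.
have y_bound t : k <= y t <= M.
  have approx e : 0 < e -> k - e <= y t <= M + e.
    move=> e0; have [n _ /(_ ord0)] := yP 1%N (fun=> t) e 0%N e0.
    have /andP[] := xkM n t; rewrite ltr_norml => h1 h2 /andP[h3 h4].
    by apply/andP; split; lra.
  apply/andP; split; apply/ler_addgt0Pr => e /approx/andP[]; lra.
have y_lip s t : `|y s - y t| <= L * `|s - t|.
  apply/ler_addgt0Pr => e e0; have e20 : 0 < e / 2 by rewrite divr_gt0.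
  have [n _ near_xn] := yP 2%N (fun i => if i == ord0 then s else t) (e / 2) 0%N e20.
  have /= := near_xn ord0; have /= := near_xn ord_max; have := xL n s t.
  rewrite !ltr_norml !ler_norml => /andP[h1 h2] /andP[h3 h4] /andP[h5 h6].
  by apply/andP; split; lra.
exists y; split=> //.
have L0 : 0 <= L by have := le_trans (normr_ge0 _) (xL 0%N 1 0); rewrite subr0 normr1 mulr1.
have pick n : exists m, (n <= m)%N /\ forall i : 'I_(2 * n.+1 * n.+1).+1,
    `|y (i%:R / n.+1%:R - n.+1%:R) - x m (i%:R / n.+1%:R - n.+1%:R)| < n.+1%:R^-1.
  have [|m nm mP] := yP _ (fun i : 'I_(2 * n.+1 * n.+1).+1 => i%:R / n.+1%:R - n.+1%:R)
    n.+1%:R^-1 n; first by rewrite invr_gt0.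
  by exists m.
have [m mP] := choice pick; exists m => [n|]; first by case: (mP n).
(* Passing from [t] to a node costs [L / (n + 1)] for [y] and again for [x (m n)]; the choice of
   [m n] adds [1 / (n + 1)]. *)
have close n t : `|t| <= n.+1%:R -> `|y t - x (m n) t| <= (2 * L + 1) / n.+1%:R.
  move=> /grid_point[j]; pose q : R := j%:R / n.+1%:R - n.+1%:R; rewrite -/q => tq.
  have h1 := le_trans (y_lip t q) (ler_wpM2l L0 tq).
  have h2 := ltW ((mP n).2 j); rewrite -/q in h2.
  have h3 := le_trans (xL (m n) t q) (ler_wpM2l L0 tq).
  move: h1 h2 h3; rewrite !ler_norml => /andP[h1 h2] /andP[h3 h4] /andP[h5 h6].
  rewrite mulrDl -mulrA mul1r; move: h1 h2 h3 h4 h5 h6.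
  by set a := L / _; set d := _^-1 => *; apply/andP; split; lra.
apply/fam_cvgP => K cK P /uniform_nbhs[E [entE EP]].
have [e e0 eE] : exists2 e : R, 0 < e & forall a b, `|a - b| < e -> E (a, b).
  move: entE; rewrite -entourage_ballE => -[e /= e0 eE]; exists e => // a b ab.
  by apply: eE; rewrite /ball /=.
have [B KB] : exists B, forall t, K t -> `|t| <= B.
  have [B [_ Bb]] := compact_bounded cK; exists (B + 1) => t Kt.
  by apply: (Bb (B + 1)) => //; rewrite ltrDl.
have : \forall n \near \oo, B <= n.+1%:R /\ (2 * L + 1) / n.+1%:R < e.
  near=> n; split.
    apply: (@le_trans _ _ n%:R); last by rewrite ler_nat.
    by near: n; exact: nbhs_infty_ger.
  rewrite ltr_pdivrMr ?ltr0n // [ltRHS]mulrC -ltr_pdivrMr //.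
  apply: (@lt_trans _ _ n%:R); last by rewrite ltr_nat.
  by near: n; exact: nbhs_infty_gtr.
apply: filterS => n [Bn en]; apply: EP => t Kt; apply: eE.
by apply: le_lt_trans en; apply: close; apply: le_trans Bn; exact: KB.
Unshelve. all: by end_near. Qed.

End ArzelaAscoli.

(** * Completeness of the space of bounded continuous functions *)

Section CompleteBC.
Variable R : realType.

Lemma BC_continuous (x : BC R) : continuous x.
Proof. by have := BC_funP x; rewrite inE => -[]. Qed.

Lemma BC_of (y : R -> R) B : continuous y -> (forall t, `|y t| <= B) ->
  exists x : BC R, x = y :> (R -> R).
Proof.
move=> cy yB; have yP : y \in bounded_continuous.
  by rewrite inE; split=> //; apply/bounded_funE; exists B => _ [t _ <-].
by exists (MkBC yP).
Qed.

(** The pointwise limit [y] is uniformly approximated by elements of the space, hence continuous and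
    bounded, and the same estimate gives convergence in norm. Banach's fixed point theorem relies on
    this. *)
Lemma BC_cauchy_cvg (F : set_system (BC R)) : ProperFilter F -> cauchy F -> cvg F.
Proof.
move=> FF /cauchyP Fc.
have Fc' e : 0 < e -> exists x : BC R, F [set z : BC R | forall t, `|x t - z t| < e].
  move=> e0; have [x Fx] := Fc e e0; exists x; apply: filterS Fx => z.
  rewrite -ball_normE /= => xz t; apply: le_lt_trans xz.
  exact: (sup_norm_ub (x - z) t).
have ptw t : exists y : R, (fun z : BC R => z t) @ F --> y.
  suff /cvg_ex[y yP] : cvg ((fun z : BC R => z t) @ F) by exists y.
  apply/cauchy_cvgP/cauchyP => e e0; have [x Fx] := Fc' e e0.
  exists (x t); suff : F [set z : BC R | `|x t - z t| < e] by [].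
  by apply: filterS Fx => z xz; exact: xz.
have [y yP] := choice ptw.
have approx e : 0 < e -> exists x : BC R, (forall t, `|x t - y t| <= e) /\
    F [set z : BC R | forall t, `|x t - z t| < e].
  move=> e0; have [x Fx] := Fc' e e0; exists x; split=> // t.
  have cv : (fun z : BC R => `|x t - z t|) @ F --> `|x t - y t|.
    by apply: cvg_norm; apply: cvgB; [exact: cvg_cst|exact: yP].
  apply: (cvgr_to_le cv); apply: filterS Fx => z xz; exact: ltW.
have [x0 [x0y _]] := approx 1 ltr01.
have cy : continuous y.
  move=> t; apply/cvgrPdist_lt => e e0.
  have e40 : 0 < e / 4 by rewrite divr_gt0.
  have [x [xy _]] := approx _ e40.
  have := @BC_continuous x t; move/cvgrPdist_lt/(_ _ e40); apply: filterS => s.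
  have := xy t; have := xy s; rewrite !ltr_norml !ler_norml.
  move=> /andP[h1 h2] /andP[h3 h4] /andP[h5 h6]; apply/andP; split; lra.
have [|z zE] := @BC_of y (sup_norm x0 + 1) cy.
  move=> t; have := sup_norm_ub x0 t; have := x0y t; rewrite !ler_norml.
  by move=> /andP[h1 h2] /andP[h3 h4]; apply/andP; split; lra.
apply/cvg_ex; exists z; apply/cvgrPdist_le => e e0.
have e20 : 0 < e / 2 by rewrite divr_gt0.
have [x [xy Fx]] := approx _ e20; apply: filterS Fx => w xw.
apply: sup_norm_le => t; rewrite (_ : BC_fun _ t = y t - w t); last by rewrite -zE.
have := xy t; have := xw t; rewrite !ler_norml ltr_norml.
by move=> /andP[h1 h2] /andP[h3 h4]; apply/andP; split; lra.
Qed.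

HB.instance Definition _ := Uniform_isComplete.Build (BC R) BC_cauchy_cvg.

End CompleteBC.

(** * Fixed points of the solution operator *)

Section LinearODEinBC.
Variable R : realType.
Implicit Types f g y : BC R.

(** Plain functions are used so that right-hand sides containing products need not be packaged in
    [BC R]. *)
Definition linear_ode (f g y : R -> R) :=
  forall t : R, is_derive t 1 y (f t - g t * y t).

Lemma solutionP (F G : BC R -> BC R) (x : BC R) :
  solution F G x <-> linear_ode (F x) (G x) x.
Proof.
split=> sol t; have := sol t.
  move=> [dx eq]; apply: DeriveDef; first exact: dx.
  by rewrite -derive1E -eq addrK.
by move=> [dx eq]; rewrite derive1E eq subrK.
Qed.

Lemma ler_BC_norm y t : `|y t| <= `|y|.
Proof. exact: sup_norm_ub. Qed.

Lemma BC_norm_le y B : (forall t, `|y t| <= B) -> `|y| <= B.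
Proof. exact: sup_norm_le. Qed.

Lemma BC_subE f g t : (f - g) t = f t - g t.
Proof. by []. Qed.

Lemma BC_sumE n (v : 'I_n -> BC R) t : (\sum_i v i : BC R) t = \sum_i v i t.
Proof. exact: (big_morph (fun z : BC R => z t)). Qed.

Variable l : R.
Hypothesis l_gt0 : 0 < l.

Lemma linear_ode_le f g y c : linear_ode f g y -> (forall t, l <= g t) ->
  (forall t, f t <= c * g t) -> forall t, y t <= c.
Proof.
move=> ode lg fc.
apply: (bounded_subsolution_le ode (ler_BC_norm y) (@BC_continuous _ g) l_gt0 lg) => t.
by rewrite subrK.
Qed.

Lemma linear_odeN (f g y : R -> R) : linear_ode f g y -> linear_ode (- f) g (- y).
Proof.
move=> ode t; have := ode t => odet; apply: is_derive_eq.
by rewrite !fctE mulrN opprB opprK addrC.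
Qed.

Lemma linear_ode_ge f g y c : linear_ode f g y -> (forall t, l <= g t) ->
  (forall t, c * g t <= f t) -> forall t, c <= y t.
Proof.
move=> ode lg fc t; rewrite -lerN2.
apply: (@linear_ode_le (- f) g (- y)) => // [|s]; first exact: linear_odeN.
by rewrite mulNr lerN2.
Qed.

Lemma linear_odeB (f1 f2 g1 g2 y1 y2 : R -> R) :
  linear_ode f1 g1 y1 -> linear_ode f2 g2 y2 ->
  linear_ode (fun t => f1 t - f2 t - (g1 t - g2 t) * y2 t) g1 (y1 - y2).
Proof.
move=> ode1 ode2 t; have := ode1 t; have := ode2 t => d2 d1; apply: is_derive_eq.
by rewrite !fctE; ring.
Qed.

Lemma linear_ode_norm_le (f : R -> R) g y K : linear_ode f g y -> (forall t, l <= g t) ->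
  (forall t, `|f t| <= K) -> `|y| <= K / l.
Proof.
move=> ode lg fK; have K0 : 0 <= K by exact: le_trans (fK 0).
have Kg t : K <= K / l * g t.
  by rewrite -mulrA ler_peMr // mulrC ler_pdivlMr // mul1r.
apply: BC_norm_le => t; rewrite ler_norml; apply/andP; split.
  rewrite lerNl.
  have yB s : `|(- (y : R -> R)) s| <= `|y| by rewrite normrN ler_BC_norm.
  apply: (bounded_subsolution_le (linear_odeN ode) yB (@BC_continuous _ g) l_gt0 lg) => s.
  rewrite subrK (le_trans _ (Kg s)) // (le_trans _ (fK s)) // -normrN; exact: ler_norm.
apply: (bounded_subsolution_le ode (ler_BC_norm y) (@BC_continuous _ g) l_gt0 lg) => s.
by rewrite subrK (le_trans _ (Kg s)) // (le_trans (ler_norm _)).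
Qed.

(** The difference solves the equation with coefficient [g1] and right-hand side
    [f1 - f2 - (g1 - g2) * y2]. Only the norm of [y2] enters, so [y2] can stay fixed while [y1]
    varies. *)
Lemma linear_ode_dist f1 f2 g1 g2 y1 y2 :
  linear_ode f1 g1 y1 -> linear_ode f2 g2 y2 -> (forall t, l <= g1 t) ->
  `|y1 - y2| <= (`|f1 - f2| + `|g1 - g2| * `|y2|) / l.
Proof.
move=> ode1 ode2 lg; apply: (@linear_ode_norm_le _ g1 (y1 - y2) _ (linear_odeB ode1 ode2) lg) => t.
rewrite (le_trans (ler_normB _ _)) // lerD ?(ler_BC_norm (f1 - f2)) //.
by rewrite normrM ler_pM // ?ler_BC_norm // (ler_BC_norm (g1 - g2)).
Qed.

Lemma linear_ode_lipschitz f g y : linear_ode f g y ->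
  forall s t, `|y s - y t| <= (`|f| + `|g| * `|y|) * `|s - t|.
Proof.
move=> ode s t; apply: (is_derive_lipschitz ode) => u.
rewrite (le_trans (ler_normB _ _)) // lerD ?ler_BC_norm //.
by rewrite normrM ler_pM // ler_BC_norm.
Qed.

End LinearODEinBC.

(** * The solution operator on [X] and its invariant band *)

Section FixedPoints.
Variables (R : realType) (X : set (BC R)) (F G : BC R -> BC R).
Hypotheses (X_closed : closed X) (X_submod : submod_closed (mem X)).
Hypothesis X_T : forall l : R, 0 < l -> forall f g : BC R, X f -> X g ->
  (forall t, l <= g t) -> exists2 h : BC R, X h & h = T f g :> (R -> R).
Hypotheses (FX : set_fun X X F) (GX : set_fun X X G).
Variable l : R.
Hypotheses (l_gt0 : 0 < l) (G_ge : forall x t, X x -> l <= G x t).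

Lemma X_linear_ode f g : X f -> X g -> (forall t, l <= g t) ->
  exists2 h, X h & linear_ode f g h.
Proof.
move=> Xf Xg lg; have [h Xh hE] := X_T l_gt0 Xf Xg lg; exists h => // t.
by rewrite hE; apply: (T_is_derive (@BC_continuous _ f) (ler_BC_norm f)
  (@BC_continuous _ g) l_gt0 lg).
Qed.

Lemma X0 : X 0.
Proof. by have [] := X_submod; rewrite inE. Qed.

Lemma X_lin a x y : X x -> X y -> X (a *: x + y).
Proof. by have [_ h] := X_submod; move=> Xx Xy; have := h a x y; rewrite !inE; apply. Qed.

Lemma X_sum n (v : 'I_n -> BC R) (a : 'I_n -> R) : (forall i, X (v i)) ->
  X (\sum_i a i *: v i).
Proof.
move=> Xv; apply: (big_ind X) => [|x y Xx Xy|i _]; first exact: X0.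
  by rewrite -(scale1r x); exact: X_lin.
by rewrite -[_ *: _]addr0; apply: X_lin => //; exact: X0.
Qed.

(* With [f = g] the constant function 1 solves the linear equation. *)
Lemma X_cst c : exists2 x, X x & forall t, x t = c.
Proof.
have [h Xh ode] := X_linear_ode (GX X0) (GX X0) (fun t => G_ge t X0).
exists (c *: h); first by rewrite -[_ *: _]addr0; apply: X_lin => //; exact: X0.
move=> t; suff h1 : h t = 1 by rewrite (_ : BC_fun _ t = c * h t) // h1 mulr1.
apply/eqP; rewrite eq_le (linear_ode_le l_gt0 ode) ?(linear_ode_ge l_gt0 ode) // => s;
  by rewrite ?mul1r ?G_ge //; exact: X0.
Qed.

Variables (k M : R).
Hypotheses (kM : k <= M).
Hypothesis FG_band : forall x t, band X k M x -> k <= F x t / G x t <= M.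

Lemma band_neq0 : band X k M !=set0.
Proof.
by have [x Xx xk] := X_cst k; exists x; split=> // t; rewrite xk lexx.
Qed.

Lemma band_closed : closed (band X k M).
Proof.
apply/closed_approxP => z approx; split.
  have /closed_approxP := X_closed; apply=> e e0.
  by have [w [Xw _] wz] := approx e e0; exists w.
move=> t; have near e : 0 < e -> k - e <= z t <= M + e.
  move=> e0; have [w [_ /(_ t) /andP[kw wM]] wz] := approx e e0.
  have := le_lt_trans (ler_BC_norm (w - z) t) wz; rewrite BC_subE ltr_norml => /andP[h1 h2].
  by apply/andP; split; lra.
apply/andP; split; apply/ler_addgt0Pr => e /near/andP[]; lra.
Qed.

Lemma solution_operator : exists Phi : BC R -> BC R, forall x, X x ->
  X (Phi x) /\ linear_ode (F x) (G x) (Phi x).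
Proof.
have h x : exists y, X x -> X y /\ linear_ode (F x) (G x) y.
  have [Xx|] := pselect (X x); last by exists 0.
  have [y Xy ode] := X_linear_ode (FX Xx) (GX Xx) (fun t => G_ge t Xx).
  by exists y.
by have [Phi] := choice h; exists Phi.
Qed.

(** As [G] is positive, the quotient condition reads [k * G <= F <= M * G], so [y] can be compared
    with the constants [k] and [M]. *)
Lemma solution_operator_band x y : band X k M x -> X y ->
  linear_ode (F x) (G x) y -> band X k M y.
Proof.
move=> xB Xy ode; split=> // t; have [Xx _] := xB.
have lG s := G_ge s Xx; have G0 s : 0 < G x s by exact: lt_le_trans (lG s).
rewrite (linear_ode_ge l_gt0 ode) ?(linear_ode_le l_gt0 ode) // => s.
  by have /andP[_] := FG_band s xB; rewrite ler_pdivrMr.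
by have /andP[+ _] := FG_band s xB; rewrite ler_pdivlMr.
Qed.

Lemma band_norm_le x : band X k M x -> `|x| <= `|k| + `|M|.
Proof.
move=> [_ xkM]; apply: BC_norm_le => t; have /andP[kx xM] := xkM t.
have := ler_norm M; have := ler_norm (- k); have := normr_ge0 k; have := normr_ge0 M.
by rewrite normrN ler_norml => *; apply/andP; split; lra.
Qed.

(** * Contraction and uniqueness in the band *)

Section Contraction.
Variables (LF LG r : R).
Hypotheses (F_lip : LF.-lipschitz_X F) (G_lip : LG.-lipschitz_X G).
Hypothesis F_le : forall x, band X k M x -> `|F x| <= r.
Let q := Num.max (r / l ^+ 2) (1 / l) * (LF + LG).

(** The constants 0 and 1 lie in [X] at a positive distance, which forces the sign. *)
Lemma lipschitz_const_ge0 (H : BC R -> BC R) L : L.-lipschitz_X H -> 0 <= L.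
Proof.
move=> H_lip; have [x Xx x0] := X_cst 0; have [y Xy y1] := X_cst 1.
have := H_lip (y, x) (conj Xy Xx) => /= Hyx.
have yx : 0 < `|y - x|.
  by apply: lt_le_trans (ler_BC_norm (y - x) 0); rewrite BC_subE x0 y1 subr0 normr1.
by rewrite -(pmulr_lge0 _ yx) (le_trans _ Hyx).
Qed.

(** As the norm of [y'] is at most [r / l], the distance estimate has the factor
    [1 / l * LF + r / l ^+ 2 * LG]; taking the maximum of both coefficients gives [q]. *)
Lemma solution_contraction (x x' y y' : BC R) : band X k M x -> band X k M x' ->
  linear_ode (F x) (G x) y -> linear_ode (F x') (G x') y' ->
  `|y - y'| <= q * `|x - x'|.
Proof.
move=> xB x'B ode ode'; have [Xx _] := xB; have [Xx' _] := x'B.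
have Fxx' : `|F x - F x'| <= LF * `|x - x'| by have := @F_lip (x, x') (conj Xx Xx').
have Gxx' : `|G x - G x'| <= LG * `|x - x'| by have := @G_lip (x, x') (conj Xx Xx').
have LF0 := lipschitz_const_ge0 F_lip; have LG0 := lipschitz_const_ge0 G_lip.
have y'r : `|y'| <= r / l.
  apply: (linear_ode_norm_le l_gt0 ode' (fun t => G_ge t Xx')) => t.
  exact: le_trans (ler_BC_norm _ _) (F_le x'B).
apply: le_trans (linear_ode_dist l_gt0 ode ode' (fun t => G_ge t Xx)) _.
apply: (@le_trans _ _ ((LF * `|x - x'| + LG * `|x - x'| * (r / l)) / l)).
  by rewrite ler_pM2r ?invr_gt0 // lerD // ler_pM.
have -> : (LF * `|x - x'| + LG * `|x - x'| * (r / l)) / l =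
    (1 / l * LF + r / l ^+ 2 * LG) * `|x - x'| by field; rewrite gt_eqF.
rewrite ler_wpM2r // /q mulrDr lerD // ler_wpM2r //.
  by rewrite le_max lexx orbT.
by rewrite le_max lexx.
Qed.

Hypothesis q_lt1 : q < 1.

Lemma contraction_solution : exists! x, band X k M x /\ solution F G x.
Proof.
have [Phi PhiP] := solution_operator.
have PhiB x : band X k M x -> band X k M (Phi x).
  move=> xB; have [Xx _] := xB; have [XP ode] := PhiP x Xx.
  exact: solution_operator_band xB XP ode.
have r0 : 0 <= r by have [x xB] := band_neq0; exact: le_trans (F_le xB).
have q0 : 0 <= q.
  rewrite mulr_ge0 ?addr_ge0 ?(lipschitz_const_ge0 F_lip) ?(lipschitz_const_ge0 G_lip) //.
  by rewrite le_max divr_ge0 // exprn_ge0 // ltW.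
pose f : {fun band X k M >-> band X k M} := mkfun_fun PhiB.
have [|x xB xE] := @banach_fixed_point R (BC R) (band X k M) f _ band_closed band_neq0.
  exists (NngNum q0); split=> //= -[x x'] /= [xB x'B].
  have [_ ode] := PhiP x xB.1; have [_ ode'] := PhiP x' x'B.1.
  exact: solution_contraction xB x'B ode ode'.
have ode : linear_ode (F x) (G x) x by rewrite {3}xE; exact: (PhiP x xB.1).2.
exists x; split; first by split=> //; apply/solutionP.
(* Solutions are their own images, so the contraction estimate bounds their distance by [q] times
   itself, and [q < 1] makes it zero. *)
move=> y [yB /solutionP ode']; apply/eqP; rewrite -subr_eq0 -normr_eq0 eq_le normr_ge0 andbT.
have := solution_contraction xB yB ode ode'.
rewrite -subr_le0 -[X in X - _]mul1r -mulrBl pmulr_rle0 // subr_gt0 //.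
Qed.

End Contraction.

(** * Compactness and existence in the band *)

Section Compactness.
Hypotheses (F_cont : {within X, continuous F}) (G_cont : {within X, continuous G}).
Variables (KF KG : R).
Hypotheses (F_le : forall x, band X k M x -> `|F x| <= KF).
Hypotheses (G_le : forall x, band X k M x -> `|G x| <= KG).
Hypothesis FG_compact : forall (x : nat -> BC R) (y : BC R), (forall n, X (x n)) ->
  {family compact, (fun n => x n : R -> R) @ \oo --> (y : R -> R)} ->
  precompact (range (F \o x)) /\ precompact (range (G \o x)).

(** By the equation, this bounds the derivative of every [y] in the band that solves it with data
    [F x], [G x] for some [x] in the band. *)
Let L := KF + KG * (`|k| + `|M|).

Definition lipschitz_band : set (BC R) :=
  [set x | band X k M x /\ forall s t, `|x s - x t| <= L * `|s - t|].

Lemma lipschitz_band_closed : closed lipschitz_band.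
Proof.
apply/closed_approxP => z approx; split.
  have /closed_approxP := band_closed; apply=> e e0.
  by have [w [wB _] wz] := approx e e0; exists w.
move=> s t; apply/ler_addgt0Pr => e e0; have e20 : 0 < e / 2 by rewrite divr_gt0.
have [w [_ /(_ s t) wL] wz] := approx _ e20.
have := le_lt_trans (ler_BC_norm (w - z) t) wz; have := le_lt_trans (ler_BC_norm (w - z) s) wz.
move: wL; rewrite !BC_subE !ltr_norml !ler_norml => /andP[h1 h2] /andP[h3 h4] /andP[h5 h6].
by apply/andP; split; lra.
Qed.

Lemma lipschitz_band_convex n (v : 'I_n -> BC R) (a : 'rV[R]_n) :
  (forall i, lipschitz_band (v i)) -> simplex a -> lipschitz_band (\sum_i a 0 i *: v i).
Proof.
move=> vC [a0 a1].
have vE t : (\sum_i a 0 i *: v i : BC R) t = \sum_i a 0 i * v i t by rewrite BC_sumE.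
split; first split.
- by apply: X_sum => i; have [[]] := vC i.
- move=> t; rewrite vE -[k]mul1r -[M]mul1r -a1 !mulr_suml.
  by apply/andP; split; apply: ler_sum => i _; rewrite ler_wpM2l //;
    have [[_ /(_ t)/andP[]]] := vC i.
- move=> s t; rewrite !vE -sumrB (le_trans (ler_norm_sum _ _ _)) //.
  rewrite -[leRHS]mul1r -a1 mulr_suml; apply: ler_sum => i _.
  rewrite -mulrBr normrM (ger0_norm (a0 i)) ler_wpM2l //.
  by have [_] := vC i.
Qed.

Lemma solution_operator_lipschitz_band (x y : BC R) : band X k M x -> X y ->
  linear_ode (F x) (G x) y -> lipschitz_band y.
Proof.
move=> xB Xy ode; have yB := solution_operator_band xB Xy ode; split=> // s t.
apply: le_trans (linear_ode_lipschitz ode s t) _; rewrite ler_wpM2r // lerD ?F_le //.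
by rewrite ler_pM // ?G_le // band_norm_le.
Qed.

(** Arzela-Ascoli gives a locally uniformly convergent subsequence; its limit is bounded and
    Lipschitz, hence in [BC R], and [FG_compact] applies along it. *)
Lemma lipschitz_band_subsequence (x : nat -> BC R) : (forall n, lipschitz_band (x n)) ->
  exists f g : BC R, forall e N, 0 < e -> exists2 n, (N <= n)%N &
    `|F (x n) - f| < e /\ `|G (x n) - g| < e.
Proof.
move=> xC.
have [y [yB yL [m mn cvg_m]]] := arzela_ascoli_lipschitz
  (fun n => (xC n).1.2) (fun n => (xC n).2).
have cy : continuous y.
  move=> t; apply/cvgrPdist_lt => e e0.
  have d0 : 0 < e / (1 + `|L|) by rewrite divr_gt0 // ltr_pwDl.
  apply: filterS (nbhsx_ballx t _ d0) => s; rewrite /ball /= => ts.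
  apply: le_lt_trans (yL t s) _; apply: (@le_lt_trans _ _ ((1 + `|L|) * `|t - s|)).
    by rewrite ler_wpM2r // (le_trans (ler_norm L)) // lerDr.
  by rewrite mulrC -ltr_pdivlMr // ltr_pwDl.
have [z zE] : exists z : BC R, z = y :> (R -> R).
  apply: (@BC_of _ y (`|k| + `|M|)) => // t; have /andP[kx xM] := yB t.
  have := ler_norm M; have := ler_norm (- k); have := normr_ge0 k; have := normr_ge0 M.
  by rewrite normrN ler_norml => *; apply/andP; split; lra.
rewrite -zE in cvg_m.
have [] := FG_compact (fun n => (xC (m n)).1.1) cvg_m.
rewrite !precompactE => cF cG.
(* Pairing the values makes [f] and [g] cluster points along the same indices. *)
pose u n : BC R * BC R := (F (x (m n)), G (x (m n))).
have cFG := compact_setX cF cG; have [|[f g] [_ clu]] := cFG (u @ \oo) _.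
  by exists 0%N => // n _; split; apply: subset_closure; exists n.
exists f, g => e N e0.
have u_tail : (u @ \oo) (u @` [set n | (N <= n)%N]) by exists N => // n Nn; exists n.
have ball_fg : nbhs (f, g) (ball f e `*` ball g e).
  by exists (ball f e, ball g e) => //; split; exact: nbhsx_ballx.
have [_ [[n Nn <-] [uf ug]]] := clu _ _ u_tail ball_fg.
exists (m n); first exact: leq_trans Nn (mn n).
split; rewrite distrC; [move: uf|move: ug]; by rewrite -ball_normE.
Qed.

Lemma compact_solution : exists2 x, band X k M x & solution F G x.
Proof.
have [Phi PhiP] := solution_operator.
have CX x : lipschitz_band x -> X x by case=> -[].
have PhiC x : lipschitz_band x -> lipschitz_band (Phi x).
  move=> [xB _]; have [XP ode] := PhiP x xB.1.
  exact: solution_operator_lipschitz_band xB XP ode.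
have lipschitz_band_neq0 : lipschitz_band !=set0.
  have [x xB] := band_neq0; have [XP ode] := PhiP x xB.1; exists (Phi x).
  exact: solution_operator_lipschitz_band xB XP ode.
(* The threshold involves [y2] but not the first solution: [y2] will be [Phi x] for continuity and
   the limit solution [h] for compactness. *)
have dist_lt (f1 f2 g1 g2 y1 y2 : BC R) e : 0 < e ->
    linear_ode f1 g1 y1 -> linear_ode f2 g2 y2 -> (forall t, l <= g1 t) ->
    `|f1 - f2| < e / (1 + `|y2|) * l -> `|g1 - g2| < e / (1 + `|y2|) * l ->
    `|y1 - y2| < e.
  move=> e0 ode1 ode2 lg f12 g12.
  apply: le_lt_trans (linear_ode_dist l_gt0 ode1 ode2 lg) _; rewrite ltr_pdivrMr //.
  have -> : e * l = e / (1 + `|y2|) * l + e / (1 + `|y2|) * l * `|y2|.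
    by field; rewrite gt_eqF // ltr_pwDl.
  by rewrite ltr_leD // ler_wpM2r // ltW.
have del0 e (y : BC R) : 0 < e -> 0 < e / (1 + `|y|) * l.
  by move=> e0; rewrite mulr_gt0 // divr_gt0 // ltr_pwDl.
have Phi_cont : {within lipschitz_band, continuous Phi}.
  apply/subspace_continuousP => x xC; apply/cvgrPdist_lt => e e0.
  have d0 := del0 e (Phi x) e0.
  have /subspace_continuousP/(_ _ (CX x xC))/cvgrPdist_lt/(_ _ d0) nF := F_cont.
  have /subspace_continuousP/(_ _ (CX x xC))/cvgrPdist_lt/(_ _ d0) nG := G_cont.
  have nP : \forall z \near x, lipschitz_band z -> `|Phi x - Phi z| < e.
    have {}nF : \forall z \near x, X z -> `|F x - F z| < e / (1 + `|Phi x|) * l by exact: nF.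
    have {}nG : \forall z \near x, X z -> `|G x - G z| < e / (1 + `|Phi x|) * l by exact: nG.
    apply: filterS2 nF nG => z Fz Gz zC; have Xz := CX z zC.
    have [_ odex] := PhiP x (CX x xC); have [_ odez] := PhiP z Xz.
    rewrite distrC; apply: (dist_lt _ _ _ _ _ _ _ e0 odez odex (fun t => G_ge t Xz));
      rewrite distrC; [exact: Fz|exact: Gz].
  by [].
have Phi_compact (x : nat -> BC R) : (forall n, lipschitz_band (x n)) ->
    exists z, forall e N, 0 < e -> exists2 m, (N <= m)%N & `|Phi (x m) - z| < e.
  move=> xC; have [f [g fgP]] := lipschitz_band_subsequence xC.
  have Xx n := CX _ (xC n).
  have Xf : X f.
    have /closed_approxP := X_closed; apply=> e /(fgP e 0%N)[n _ [nf _]].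
    by exists (F (x n)) => //; exact: FX.
  have Xg : X g.
    have /closed_approxP := X_closed; apply=> e /(fgP e 0%N)[n _ [_ ng]].
    by exists (G (x n)) => //; exact: GX.
  (* The lower bound passes to the limit, so the equation with data [f] and [g] has a solution in
     [X], the desired cluster point of the images. *)
  have lg t : l <= g t.
    apply/ler_addgt0Pr => e e0; have [n _ [_ ng]] := fgP e 0%N e0.
    have := le_lt_trans (ler_BC_norm (G (x n) - g) t) ng; have := G_ge t (Xx n).
    by rewrite BC_subE ltr_norml => h /andP[h1 h2]; lra.
  have [h Xh ode] := X_linear_ode Xf Xg lg; exists h => e N e0.
  have [n Nn [nf ng]] := fgP _ N (del0 e h e0); exists n => //.
  have [_ oden] := PhiP _ (Xx n).
  exact: (dist_lt _ _ _ _ _ _ _ e0 oden ode (fun t => G_ge t (Xx n))).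
have [x xC xE] := schauder lipschitz_band_closed lipschitz_band_neq0
  lipschitz_band_convex PhiC Phi_cont Phi_compact.
exists x; first by case: xC.
by apply/solutionP; rewrite -{3}xE; exact: (PhiP x (CX x xC)).2.
Qed.

End Compactness.

End FixedPoints.

Theorem theorem1 (R : realType) (X : set (BC R)) (F G : BC R -> BC R)
    (X_closed : closed X) (X_submod : submod_closed (mem X))
    (X_T : forall l : R, 0 < l -> forall f g : BC R, X f -> X g ->
      (forall t, l <= g t) -> exists2 h : BC R, X h & h = T f g :> (R -> R))
    (FX : set_fun X X F) (GX : set_fun X X G) :
  (forall k M : R,
    {within X, continuous F} -> {within X, continuous G} ->
    0 < inf [set G x t | x in X & t in [set: R]] ->
    k <= M ->
    [bounded F x | x in band X k M] -> [bounded G x | x in band X k M] ->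
    (forall x t, band X k M x -> k <= F x t / G x t <= M) ->
    (forall (x : nat -> BC R) (y : BC R), (forall n, X (x n)) ->
      {family compact, (fun n => x n : R -> R) @ \oo --> (y : R -> R)} ->
      precompact (range (F \o x)) /\ precompact (range (G \o x))) ->
    exists2 x : BC R, band X k M x & solution F G x)
  /\
  (forall (LF LG l r k M : R),
    LF.-lipschitz_X F -> LG.-lipschitz_X G ->
    l = inf [set G x t | x in X & t in [set: R]] -> 0 < l ->
    k <= M ->
    (forall x t, band X k M x -> k <= F x t / G x t <= M) ->
    has_ubound [set `|F x| | x in band X k M] ->
    r = sup [set `|F x| | x in band X k M] ->
    Num.max (r / l ^+ 2) (1 / l) * (LF + LG) < 1 ->
    exists! x : BC R, band X k M x /\ solution F G x).
Proof.
have G_inf x t : 0 < inf [set G x t | x in X & t in [set: R]] -> X x ->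
    inf [set G x t | x in X & t in [set: R]] <= G x t.
  move=> inf0 Xx; apply: ge_inf; last by exists x => //; exists t.
  (* By convention [inf] is 0 when there is no infimum, so positivity supplies the lower bound. *)
  have [[]//|/inf_out inf_0] := pselect (has_inf [set G x t | x in X & t in [set: R]]).
  by move: inf0; rewrite inf_0 ltxx.
split.
  move=> k M F_cont G_cont inf0 kM [KF [_ F_le]] [KG [_ G_le]] FG_band FG_compact.
  (* Boundedness provides every bound strictly above [KF] and [KG], hence the shift by 1. *)
  apply: (compact_solution X_closed X_submod X_T FX GX inf0 (fun x t => @G_inf x t inf0)
    kM FG_band F_cont G_cont (KF := KF + 1) (KG := KG + 1) _ _ FG_compact).
    by move=> x xB; apply: (F_le (KF + 1)) => //; rewrite ltrDl.
  by move=> x xB; apply: (G_le (KG + 1)) => //; rewrite ltrDl.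
move=> LF LG l r k M F_lip G_lip -> inf0 kM FG_band F_ub -> q_lt1.
apply: (contraction_solution X_closed X_submod X_T FX GX inf0 (fun x t => @G_inf x t inf0)
  kM FG_band F_lip G_lip _ q_lt1).
by move=> x xB; apply: ub_le_sup => //; exists x.
Qed.
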